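(* Let $M$ be a meridian surface of type $\mathcal{M}'_b$, i.e. $z(u,v)=f(u)\,l(v)+g(u)\,e_4$ with $l$ a timelike unit-speed curve on $\mathbb{S}^2_1(1)\subset\mathrm{span}\{e_1,e_2,e_3\}$ (respectively, of type $\widetilde{\mathcal{M}}''_a$, i.e. $z(u,v)=g(u)\,e_1+f(u)\,l(v)$ with $l$ a spacelike unit-speed curve on $\mathbb{H}^2_1(-1)\subset\mathrm{span}\{e_2,e_3,e_4\}$), where $f'^2-g'^2=1$ and $g'$ is nowhere zero. Let $\kappa$ be the spherical curvature of the curve $l$ and assume that $\kappa$ is not identically zero. Then $M$ has parallel normalized mean curvature vector field but not parallel mean curvature vector field if and only if one of the following cases holds: (i) $\kappa\neq0$ everywhere and the meridian is given by $$f(u)=\pm\sqrt{u^2+2au+b},\qquad g(u)=\pm\sqrt{a^2-b}\,\ln\left|u+a+\sqrt{u^2+2au+b}\right|+c,$$ where $a,b,c$ are real constants with $a^2-b>0$. (ii) the curve $l$ has non-zero constant spherical curvature $\kappa$ and the meridian is determined by $f'=\varphi(f)$, where $$\varphi(t)=\pm\frac1t\sqrt{(ct+a)^2+t^2},\qquad a=\mathrm{const},\quad c=\mathrm{const}\neq0,\quad c^2\neq\kappa^2,$$ and $g$ is determined, up to replacing $g$ by $-g$, by $g'=\sqrt{f'^2-1}$.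
   Context: Ambient space: $\mathbb{E}^4_2$ is $\mathbb{R}^4$ with the metric $\langle\cdot,\cdot\rangle=dx_1^2+dx_2^2-dx_3^2-dx_4^2$; $e_1,e_2,e_3,e_4$ is the standard basis, so $\langle e_1,e_1\rangle=\langle e_2,e_2\rangle=1$, $\langle e_3,e_3\rangle=\langle e_4,e_4\rangle=-1$. A vector $v$ is spacelike if $\langle v,v\rangle>0$ or $v=0$, timelike if $\langle v,v\rangle<0$. Meridian surfaces: $f,g$ are smooth real functions on an open interval $I$, $f$ nowhere zero; $l$ is a smooth curve on an open interval $J$; $u\in I$, $v\in J$. The curve $u\mapsto(f(u),g(u))$ is called the meridian. The standing assumption that $g'$ is nowhere zero is equivalent here to $f'^2>1$. Type $\mathcal{M}'_b$: $z(u,v)=f(u)l(v)+g(u)e_4$, where $l(v)=\cosh w^1\cos w^2\,e_1+\cosh w^1\sin w^2\,e_2+\sinh w^1\,e_3$ with $w^1=w^1(v)$, $w^2=w^2(v)$ smooth, a curve on $\mathbb{S}^2_1(1)=\{V\in\mathrm{span}\{e_1,e_2,e_3\}:\langle V,V\rangle=1\}$ with $\langle l',l'\rangle=-1$, and $f'^2-g'^2=1$. The first fundamental form is $E=1$, $F=0$, $G=-f^2$. Type $\widetilde{\mathcal{M}}''_a$: $z(u,v)=g(u)e_1+f(u)l(v)$, where $l(v)=\sinh w^1\,e_2+\cosh w^1\cos w^2\,e_3+\cosh w^1\sin w^2\,e_4$ with $w^1,w^2$ smooth functions of $v$, a curve on $\mathbb{H}^2_1(-1)=\{V\in\mathrm{span}\{e_2,e_3,e_4\}:\langle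 V,V\rangle=-1\}$ with $\langle l',l'\rangle=1$, and $f'^2-g'^2=1$. The first fundamental form is $E=-1$, $F=0$, $G=f^2$. (This surface is the image of a surface of type $\mathcal{M}'_b$ under the linear map $T(x_1,x_2,x_3,x_4)=(x_4,x_3,x_1,x_2)$, which reverses the sign of the metric.) Both are Lorentz surfaces (induced metric of signature $(1,1)$). Spherical curvature: let $t=l'$ and let $n(v)$ be the smooth vector field, unique up to sign, in the 3-dimensional space containing $l$, such that $\{l,t,n\}$ is an orthonormal frame (so $\langle n,n\rangle=\pm1$). Then $\kappa(v)=\langle t'(v),n(v)\rangle$ (its overall sign depends on the choice of $n$ and is immaterial here). Mean curvature: $h$ is the second fundamental form, $H=\tfrac12\,\mathrm{tr}\,h$ (trace with respect to the induced metric) is the mean curvature vector field, $D$ is the normal connection. The surface has parallel mean curvature vector field if $DH=0$ identically. It has parallel normalized mean curvature vector field if $\langle H,H\rangle\neq0$ at every point and there is a smooth unit normal vector field $b$ ($\langle b,b\rangle=\pm1$) in the direction of $H$ (i.e. $H$ is a nowhere-zero multiple of $b$) with $Db=0$ identically. Convention: in (i) the interval $I$ is such that $u^2+2au+b>0$ on $I$; all signs $\pm$ are independent and fixed on $I$. *)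

(* Defs.v *)
From Stdlib Require Import Reals.
From Coquelicot Require Import Coquelicot.
Open Scope R_scope.

Definition E4 : NormedModule R_AbsRing :=
  prod_NormedModule R_AbsRing
    (prod_NormedModule R_AbsRing
      (prod_NormedModule R_AbsRing R_NormedModule R_NormedModule)
      R_NormedModule)
    R_NormedModule.

Definition mkE4 (a b c d : R) : E4 := (a, b, c, d).

Definition x1 (p : E4) : R := fst (fst (fst p)).
Definition x2 (p : E4) : R := snd (fst (fst p)).
Definition x3 (p : E4) : R := snd (fst p).
Definition x4 (p : E4) : R := snd p.

Definition e1 : E4 := mkE4 1 0 0 0.
Definition e2 : E4 := mkE4 0 1 0 0.
Definition e3 : E4 := mkE4 0 0 1 0.
Definition e4 : E4 := mkE4 0 0 0 1.

Definition inner (p q : E4) : R :=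
  x1 p * x1 q + x2 p * x2 q - x3 p * x3 q - x4 p * x4 q.

Definition is_unit_vector (p : E4) : Prop := inner p p = 1 \/ inner p p = -1.

Definition is_open_interval (I : R -> Prop) : Prop :=
  exists lo hi : Rbar, Rbar_lt lo hi /\
    forall x : R, I x <-> Rbar_lt lo x /\ Rbar_lt x hi.

Definition smooth_on (I : R -> Prop) (f : R -> R) : Prop :=
  forall x, I x -> forall n, ex_derive_n f n x.

Definition smooth_curve_on (I : R -> Prop) (c : R -> E4) : Prop :=
  smooth_on I (fun t => x1 (c t)) /\ smooth_on I (fun t => x2 (c t)) /\
  smooth_on I (fun t => x3 (c t)) /\ smooth_on I (fun t => x4 (c t)).

Definition smooth_on2 (I J : R -> Prop) (F : R -> R -> R) : Prop :=
  forall u v, I u -> J v -> forall n, ex_diff_n F n u v.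

Definition smooth_field_on (I J : R -> Prop) (X : R -> R -> E4) : Prop :=
  smooth_on2 I J (fun u v => x1 (X u v)) /\
  smooth_on2 I J (fun u v => x2 (X u v)) /\
  smooth_on2 I J (fun u v => x3 (X u v)) /\
  smooth_on2 I J (fun u v => x4 (X u v)).

Definition DeriveE (c : R -> E4) (t : R) : E4 :=
  mkE4 (Derive (fun s => x1 (c s)) t) (Derive (fun s => x2 (c s)) t)
       (Derive (fun s => x3 (c s)) t) (Derive (fun s => x4 (c s)) t).

Definition partial_u (X : R -> R -> E4) (u v : R) : E4 :=
  DeriveE (fun s => X s v) u.
Definition partial_v (X : R -> R -> E4) (u v : R) : E4 :=
  DeriveE (fun s => X u s) v.

(** The quotients below are by E G - F^2, so the definitions are meaningful
    only where the induced metric is non-degenerate. *)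

Definition ffE (z : R -> R -> E4) (u v : R) : R :=
  inner (partial_u z u v) (partial_u z u v).
Definition ffF (z : R -> R -> E4) (u v : R) : R :=
  inner (partial_u z u v) (partial_v z u v).
Definition ffG (z : R -> R -> E4) (u v : R) : R :=
  inner (partial_v z u v) (partial_v z u v).
Definition ffdet (z : R -> R -> E4) (u v : R) : R :=
  ffE z u v * ffG z u v - (ffF z u v) ^ 2.

(** The tangential part is p z_u + q z_v, with (p, q) solving the linear
    system p E + q F = <w, z_u>, p F + q G = <w, z_v>. *)
Definition tangent_part (z : R -> R -> E4) (u v : R) (w : E4) : E4 :=
  let zu := partial_u z u v in
  let zv := partial_v z u v in
  plus
    (scal ((ffG z u v * inner w zu - ffF z u v * inner w zv) / ffdet z u v) zu)
    (scal ((ffE z u v * inner w zv - ffF z u v * inner w zu) / ffdet z u v) zv).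

Definition normal_part (z : R -> R -> E4) (u v : R) (w : E4) : E4 :=
  minus w (tangent_part z u v w).

Definition is_normal (z : R -> R -> E4) (u v : R) (w : E4) : Prop :=
  inner w (partial_u z u v) = 0 /\ inner w (partial_v z u v) = 0.

(** Gauss formula: [h_uu], [h_uv], [h_vv] are the values of the second
    fundamental form on the coordinate fields. *)
Definition h_uu (z : R -> R -> E4) (u v : R) : E4 :=
  normal_part z u v (partial_u (partial_u z) u v).
Definition h_uv (z : R -> R -> E4) (u v : R) : E4 :=
  normal_part z u v (partial_u (partial_v z) u v).
Definition h_vv (z : R -> R -> E4) (u v : R) : E4 :=
  normal_part z u v (partial_v (partial_v z) u v).

Definition mean_curvature (z : R -> R -> E4) (u v : R) : E4 :=
  scal (1 / 2)
    (scal (/ ffdet z u v)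
      (plus (minus (scal (ffG z u v) (h_uu z u v))
                   (scal (2 * ffF z u v) (h_uv z u v)))
            (scal (ffE z u v) (h_vv z u v)))).

(** Weingarten formula: D xi = 0 iff [D_u] and [D_v] vanish, since D is linear
    in the tangent direction. *)
Definition D_u (z xi : R -> R -> E4) (u v : R) : E4 :=
  normal_part z u v (partial_u xi u v).
Definition D_v (z xi : R -> R -> E4) (u v : R) : E4 :=
  normal_part z u v (partial_v xi u v).

Definition parallel_on (I J : R -> Prop) (z xi : R -> R -> E4) : Prop :=
  forall u v, I u -> J v -> D_u z xi u v = zero /\ D_v z xi u v = zero.

Definition parallel_mean_curvature (I J : R -> Prop) (z : R -> R -> E4) : Prop :=
  parallel_on I J z (mean_curvature z).

Definition parallel_normalized_mean_curvature
    (I J : R -> Prop) (z : R -> R -> E4) : Prop :=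
  (forall u v, I u -> J v ->
     inner (mean_curvature z u v) (mean_curvature z u v) <> 0) /\
  exists b : R -> R -> E4,
    smooth_field_on I J b /\
    (forall u v, I u -> J v ->
       is_normal z u v (b u v) /\
       is_unit_vector (b u v) /\
       exists lambda : R, lambda <> 0 /\
         mean_curvature z u v = scal lambda (b u v)) /\
    parallel_on I J z b.

(** [Mb] is the type M'_b and [Ma] the type M''_a with a tilde. *)

Inductive meridian_kind : Set := Mb | Ma.

Definition curve (K : meridian_kind) (w1 w2 : R -> R) (v : R) : E4 :=
  match K with
  | Mb => mkE4 (cosh (w1 v) * cos (w2 v)) (cosh (w1 v) * sin (w2 v))
               (sinh (w1 v)) 0
  | Ma => mkE4 0 (sinh (w1 v))
               (cosh (w1 v) * cos (w2 v)) (cosh (w1 v) * sin (w2 v))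
  end.

Definition in_curve_space (K : meridian_kind) (p : E4) : Prop :=
  match K with
  | Mb => exists r1 r2 r3 : R, p = plus (plus (scal r1 e1) (scal r2 e2)) (scal r3 e3)
  | Ma => exists r2 r3 r4 : R, p = plus (plus (scal r2 e2) (scal r3 e3)) (scal r4 e4)
  end.

Definition axis (K : meridian_kind) : E4 :=
  match K with Mb => e4 | Ma => e1 end.

(** <l', l'>: the curve is timelike for [Mb], spacelike for [Ma]. *)
Definition speed_value (K : meridian_kind) : R :=
  match K with Mb => -1 | Ma => 1 end.

Definition meridian_surface (K : meridian_kind) (f g w1 w2 : R -> R)
    (u v : R) : E4 :=
  plus (scal (f u) (curve K w1 w2 v)) (scal (g u) (axis K)).

Record is_meridian_surface (K : meridian_kind) (I J : R -> Prop)
    (f g w1 w2 : R -> R) : Prop := {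
  mer_f_smooth : smooth_on I f;
  mer_g_smooth : smooth_on I g;
  mer_w1_smooth : smooth_on J w1;
  mer_w2_smooth : smooth_on J w2;
  mer_f_neq0 : forall u, I u -> f u <> 0;
  mer_meridian : forall u, I u -> (Derive f u) ^ 2 - (Derive g u) ^ 2 = 1;
  mer_unit_speed : forall v, J v ->
    inner (DeriveE (curve K w1 w2) v) (DeriveE (curve K w1 w2) v) = speed_value K
}.

Definition is_orthonormal3 (p q r : E4) : Prop :=
  is_unit_vector p /\ is_unit_vector q /\ is_unit_vector r /\
  inner p q = 0 /\ inner p r = 0 /\ inner q r = 0.

Definition is_frame_normal (K : meridian_kind) (J : R -> Prop)
    (w1 w2 : R -> R) (n : R -> E4) : Prop :=
  smooth_curve_on J n /\
  forall v, J v ->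
    in_curve_space K (n v) /\
    is_orthonormal3 (curve K w1 w2 v) (DeriveE (curve K w1 w2) v) (n v).

Definition spherical_curvature (K : meridian_kind) (w1 w2 : R -> R)
    (n : R -> E4) (v : R) : R :=
  inner (DeriveE (DeriveE (curve K w1 w2)) v) (n v).

Definition is_sign (s : R) : Prop := s = 1 \/ s = -1.

Definition case_i (I J : R -> Prop) (f g kappa : R -> R) : Prop :=
  (forall v, J v -> kappa v <> 0) /\
  exists a b c s1 s2 : R,
    is_sign s1 /\ is_sign s2 /\ a ^ 2 - b > 0 /\
    forall u, I u ->
      u ^ 2 + 2 * a * u + b > 0 /\
      f u = s1 * sqrt (u ^ 2 + 2 * a * u + b) /\
      g u = s2 * sqrt (a ^ 2 - b)
              * ln (Rabs (u + a + sqrt (u ^ 2 + 2 * a * u + b))) + c.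

Definition phi (s a c t : R) : R :=
  s * (1 / t * sqrt ((c * t + a) ^ 2 + t ^ 2)).

Definition case_ii (I J : R -> Prop) (f g kappa : R -> R) : Prop :=
  exists k : R, k <> 0 /\ (forall v, J v -> kappa v = k) /\
  exists a c s s' : R,
    is_sign s /\ is_sign s' /\ c <> 0 /\ c ^ 2 <> k ^ 2 /\
    forall u, I u ->
      Derive f u = phi s a c (f u) /\
      Derive (fun x => s' * g x) u = sqrt ((Derive f u) ^ 2 - 1).

(* Main.v *)
Require Import Defs.
From Stdlib Require Import Reals Lra.
From Coquelicot Require Import Coquelicot.
Open Scope R_scope.

(** Put [e = 1] for [Mb] and [e = -1] for [Ma], [t = l'] and [k = e kappa]. The
    vectors [l, t, n, axis] form an orthonormal frame with signs [(e, -e, e, -e)]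
    in both cases, and [l' = t], [t' = l + k n], [n' = k t]. Boosting [l] and
    [axis] by [(f', g')] gives the tangent vector [z_u = f' l + g' axis] and a unit
    normal [N = g' l + f' axis]; together with [t = z_v / f] and [n] they are a
    frame adapted to the surface.

    Two facts carry the geometry. First, [N] and [n] are parallel in the normal
    bundle ([D_u_field], [D_v_field]): their derivatives are tangent to the
    surface. Therefore a normal field is parallel exactly when its components in
    [N] and [n] are constant. Second, the mean curvature vector is
    [H = e / (2 f) (mu N - k n)], where [mu = (f f'' + f'^2 - 1) / g'] depends on [u]
    only and [k] on [v] only ([surface_mean_curvature]).

    It follows that [H] is never parallel, as [k / f] would not depend on [u]
    whereas [f'^2 = 1 + g'^2 > 1]. And a unit normal field along [H] is parallel
    exactly when the direction of [(mu, kappa)] is constant, that is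
    [mu u = r * kappa v] for a constant [r]; the non-vanishing of [<H, H>] adds that
    [kappa] has no zero and that [r^2 <> 1] ([parallel_normalized_iff]).

    If [r = 0], then [mu = 0] and nothing more is required of [kappa]: this is
    case (i). If [r <> 0], the variables separate, so [kappa] and [mu] are non-zero
    constants with [mu^2 <> kappa^2]: this is case (ii). It remains to integrate
    [mu = m]. Along the meridian [(f g')' = mu f'], so that [mu = m] is equivalent to
    [f g' = m f + a] ([axial_trace_first_integral]); with [f'^2 = 1 + g'^2] this is
    the first order equation of case (ii), and for [m = 0] it is solved by a
    quadrature to the formulas of case (i). *)

(** * Open intervals *)

Lemma open_interval_locally (I : R -> Prop) (x : R) :
  is_open_interval I -> I x -> locally x I.
Proof.
  intros [lo [hi [_ HI]]] Hx.
  apply HI in Hx; destruct Hx as [H1 H2].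
  generalize (filter_and _ _ (open_Rbar_gt lo x H1) (open_Rbar_lt hi x H2)).
  apply filter_imp; intros y Hy; now apply HI.
Qed.

Lemma open_interval_inhabited (I : R -> Prop) :
  is_open_interval I -> exists x, I x.
Proof.
  intros [lo [hi [Hlt HI]]].
  destruct lo as [lo| |]; destruct hi as [hi| |]; simpl in Hlt; try easy.
  - exists ((lo + hi) / 2); apply HI; simpl; lra.
  - exists (lo + 1); apply HI; simpl; lra.
  - exists (hi - 1); apply HI; simpl; lra.
  - exists 0; apply HI; simpl; easy.
Qed.

Lemma open_interval_between (I : R -> Prop) (x y t : R) :
  is_open_interval I -> I x -> I y -> x <= t <= y -> I t.
Proof.
  intros [lo [hi [_ HI]]] Hx Hy Ht.
  apply HI in Hx; apply HI in Hy; apply HI; split.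
  - apply Rbar_lt_le_trans with x; [apply Hx | apply Ht].
  - apply Rbar_le_lt_trans with y; [apply Ht | apply Hy].
Qed.

Lemma constant_of_derive_zero (I : R -> Prop) (h : R -> R) :
  is_open_interval I -> (forall x, I x -> is_derive h x 0) ->
  forall x y, I x -> I y -> h x = h y.
Proof.
  intros HI Hd.
  assert (Hlt : forall x y, I x -> I y -> x < y -> h x = h y).
  { intros x y Hx Hy Hxy.
    apply (eq_is_derive h x y); [|exact Hxy].
    intros t Ht; apply Hd; exact (open_interval_between I x y t HI Hx Hy Ht). }
  intros x y Hx Hy.
  destruct (Rtotal_order x y) as [H | [H | H]].
  - now apply Hlt.
  - now subst.
  - symmetry; now apply Hlt.
Qed.

Lemma constant_sign (I : R -> Prop) (h : R -> R) :
  is_open_interval I -> (forall x, I x -> ex_derive h x) ->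
  (forall x, I x -> h x <> 0) ->
  exists s, is_sign s /\ forall x, I x -> 0 < s * h x.
Proof.
  intros HI Hd Hne.
  assert (Hc : forall x, I x -> continuity_pt h x).
  { intros x Hx; apply continuity_pt_filterlim.
    exact (ex_derive_continuous h x (Hd x Hx)). }
  assert (Hkey : forall s x y, I x -> I y -> x < y ->
            s * h x < 0 -> 0 < s * h y -> False).
  { intros s x y Hx Hy Hxy Hnx Hpy.
    destruct (Ranalysis5.IVT_interv (fun t => s * h t) x y) as [z [Hz Hz0]]; auto.
    - intros t Ht; apply continuity_pt_mult.
      + apply continuity_pt_const; now intros ? ?.
      + apply Hc; exact (open_interval_between I x y t HI Hx Hy Ht).
    - destruct (Rmult_integral _ _ Hz0) as [Hs | Hh]; [subst s; lra|].
      exact (Hne z (open_interval_between I x y z HI Hx Hy Hz) Hh). }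
  destruct (open_interval_inhabited I HI) as [x0 Hx0].
  assert (Hs : exists s, is_sign s /\ 0 < s * h x0).
  { destruct (Rtotal_order (h x0) 0) as [H | [H | H]].
    - exists (-1); split; [now right | lra].
    - now elim (Hne x0 Hx0).
    - exists 1; split; [now left | lra]. }
  destruct Hs as [s [Hs Hs0]].
  exists s; split; [exact Hs|]; intros x Hx.
  destruct (Rtotal_order (s * h x) 0) as [H | [H | H]]; [|exfalso|exact H].
  - exfalso; destruct (Rtotal_order x x0) as [H' | [H' | H']].
    + now apply (Hkey s x x0).
    + subst; lra.
    + apply (Hkey (- s) x0 x); auto; lra.
  - destruct (Rmult_integral _ _ H) as [H' | H'].
    + subst; destruct Hs; lra.
    + exact (Hne x Hx H').
Qed.

(** * Smoothness *)

Lemma smooth_on_ex_derive (I : R -> Prop) (f : R -> R) (x : R) :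
  smooth_on I f -> I x -> ex_derive f x.
Proof. intros H Hx; exact (H x Hx 1%nat). Qed.

Lemma smooth_on_Derive (I : R -> Prop) (f : R -> R) :
  smooth_on I f -> smooth_on I (Derive f).
Proof.
  intros H x Hx [|n]; [exact Logic.I|]; simpl.
  apply ex_derive_ext with (Derive_n f (n + 1)).
  - intros t; symmetry; exact (Derive_n_comp f n 1 t).
  - generalize (H x Hx (S (n + 1))); easy.
Qed.

(** Coinductive form of smoothness: it avoids Leibniz and chain rules of every
    order, since only first derivatives have to be computed. *)
Lemma smooth_on_derivation_closed (I : R -> Prop) (P : (R -> R) -> Prop) :
  is_open_interval I ->
  (forall f, P f -> exists f', P f' /\ forall x, I x -> is_derive f x (f' x)) ->
  forall f, P f -> smooth_on I f.
Proof.
  intros HI HP.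
  assert (H : forall n f, P f -> exists h, P h /\
            forall x, I x -> Derive_n f n x = h x).
  { induction n as [|n IH]; intros f Hf.
    - now exists f.
    - destruct (IH f Hf) as [h [Hh Hfh]]; destruct (HP h Hh) as [h' [Hh' Hd]].
      exists h'; split; [exact Hh'|]; intros x Hx; simpl.
      rewrite <- (is_derive_unique h x (h' x)); [|now apply Hd].
      apply Derive_ext_loc.
      generalize (open_interval_locally I x HI Hx); apply filter_imp; auto. }
  intros f Hf x Hx [|n]; [exact Logic.I|]; simpl.
  destruct (H n f Hf) as [h [Hh Hfh]]; destruct (HP h Hh) as [h' [Hh' Hd]].
  apply ex_derive_ext_loc with h.
  - generalize (open_interval_locally I x HI Hx); apply filter_imp.
    intros y Hy; symmetry; auto.
  - exists (h' x); auto.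
Qed.

Lemma smooth_on_const (I : R -> Prop) (c : R) :
  is_open_interval I -> smooth_on I (fun _ => c).
Proof.
  intros HI.
  apply (smooth_on_derivation_closed I (fun f => exists c, f = fun _ => c)); auto.
  - intros f [c' ->]; exists (fun _ => 0); split; [now exists 0|].
    intros x _; exact (is_derive_const c' x).
  - now exists c.
Qed.

Inductive generated_algebra (base : (R -> R) -> Prop) : (R -> R) -> Prop :=
| gen_base f : base f -> generated_algebra base f
| gen_plus f g : generated_algebra base f -> generated_algebra base g ->
    generated_algebra base (fun x => f x + g x)
| gen_mult f g : generated_algebra base f -> generated_algebra base g ->
    generated_algebra base (fun x => f x * g x).

(** By the Leibniz rule the algebra generated by [base] is closed under
    derivation as soon as it contains the derivatives of its generators. *)
Lemma smooth_on_generated (I : R -> Prop) (base : (R -> R) -> Prop) :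
  is_open_interval I ->
  (forall f, base f -> exists f', generated_algebra base f' /\
     forall x, I x -> is_derive f x (f' x)) ->
  forall f, generated_algebra base f -> smooth_on I f.
Proof.
  intros HI Hbase; apply smooth_on_derivation_closed; [exact HI|].
  intros f Hf; induction Hf as [f Hf | f g Hf [f' [Gf' Hf']] Hg [g' [Gg' Hg']]
                                    | f g Hf [f' [Gf' Hf']] Hg [g' [Gg' Hg']]].
  - now apply Hbase.
  - exists (fun x => f' x + g' x); split; [now apply gen_plus|].
    intros x Hx; apply (is_derive_plus f g); auto.
  - exists (fun x => f' x * g x + f x * g' x); split.
    + apply gen_plus; now apply gen_mult.
    + intros x Hx; apply (is_derive_mult f g); auto; intros; apply Rmult_comm.
Qed.

(** The generators needed for the coordinates of [curve]; the chain rule sends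
    each of them into the algebra they generate. *)
Inductive elementary_of_smooth (I : R -> Prop) : (R -> R) -> Prop :=
| elem_smooth f : smooth_on I f -> elementary_of_smooth I f
| elem_cos f : smooth_on I f -> elementary_of_smooth I (fun x => cos (f x))
| elem_sin f : smooth_on I f -> elementary_of_smooth I (fun x => sin (f x))
| elem_cosh f : smooth_on I f -> elementary_of_smooth I (fun x => cosh (f x))
| elem_sinh f : smooth_on I f -> elementary_of_smooth I (fun x => sinh (f x)).

Lemma smooth_on_elementary (I : R -> Prop) (f : R -> R) :
  is_open_interval I -> generated_algebra (elementary_of_smooth I) f ->
  smooth_on I f.
Proof.
  intros HI; revert f; apply smooth_on_generated; [exact HI|].
  assert (Hconst := smooth_on_const I (-1) HI).
  assert (Hchain : forall F F' h, (forall y, is_derive F y (F' y)) ->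
            smooth_on I h -> forall x, I x ->
            is_derive (fun x => F (h x)) x (Derive h x * F' (h x))).
  { intros F F' h HF Hh x Hx; apply (is_derive_comp F h); auto.
    apply Derive_correct; now apply smooth_on_ex_derive with I. }
  intros f [h Hh | h Hh | h Hh | h Hh | h Hh].
  - exists (Derive h); split.
    + apply gen_base, elem_smooth; now apply smooth_on_Derive.
    + intros x Hx; apply Derive_correct; now apply smooth_on_ex_derive with I.
  - exists (fun x => Derive h x * (-1 * sin (h x))); split.
    + apply gen_mult; [|apply (gen_mult _ (fun _ => -1))]; apply gen_base.
      * apply elem_smooth; now apply smooth_on_Derive.
      * now apply elem_smooth.
      * now apply elem_sin.
    + intros x Hx; apply (Hchain cos (fun y => -1 * sin y)); auto.
      intros y; replace (-1 * sin y) with (- sin y) by ring; apply is_derive_cos.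
  - exists (fun x => Derive h x * cos (h x)); split.
    + apply gen_mult; apply gen_base.
      * apply elem_smooth; now apply smooth_on_Derive.
      * now apply elem_cos.
    + now intros x Hx; apply (Hchain sin cos); auto using is_derive_sin.
  - exists (fun x => Derive h x * sinh (h x)); split.
    + apply gen_mult; apply gen_base.
      * apply elem_smooth; now apply smooth_on_Derive.
      * now apply elem_sinh.
    + intros x Hx; apply (Hchain cosh sinh); auto.
      intros y; apply is_derive_Reals, derivable_pt_lim_cosh.
  - exists (fun x => Derive h x * cosh (h x)); split.
    + apply gen_mult; apply gen_base.
      * apply elem_smooth; now apply smooth_on_Derive.
      * now apply elem_cosh.
    + intros x Hx; apply (Hchain sinh cosh); auto.
      intros y; apply is_derive_Reals, derivable_pt_lim_sinh.
Qed.

(** A family of functions of two variables that is visibly closed under both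
    partial derivatives, so that [ex_diff_n] follows by induction on the order;
    it contains the coordinates of the normal fields considered below. *)
Inductive separable_sum (I J : R -> Prop) : (R -> R -> R) -> Prop :=
| sep_mult p q : smooth_on I p -> smooth_on J q ->
    separable_sum I J (fun u v => p u * q v)
| sep_plus F G : separable_sum I J F -> separable_sum I J G ->
    separable_sum I J (fun u v => F u v + G u v).

Lemma separable_sum_derivatives (I J : R -> Prop) (F : R -> R -> R) :
  separable_sum I J F ->
  (forall u v, I u -> J v -> continuity_2d_pt F u v) /\
  (exists Fu, separable_sum I J Fu /\
     forall u v, I u -> J v -> is_derive (fun s => F s v) u (Fu u v)) /\
  (exists Fv, separable_sum I J Fv /\
     forall u v, I u -> J v -> is_derive (fun s => F u s) v (Fv u v)).
Proof.
  induction 1 as [p q Hp Hq | F G HF [CF [[Fu [SFu DFu]] [Fv [SFv DFv]]]]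
                                  HG [CG [[Gu [SGu DGu]] [Gv [SGv DGv]]]]].
  - split; [|split].
    + intros u v Hu Hv; apply continuity_2d_pt_mult.
      * apply (continuity_1d_2d_pt_comp p (fun u _ => u));
          [|apply continuity_2d_pt_id1].
        apply continuity_pt_filterlim; apply (ex_derive_continuous p).
        now apply smooth_on_ex_derive with I.
      * apply (continuity_1d_2d_pt_comp q (fun _ v => v));
          [|apply continuity_2d_pt_id2].
        apply continuity_pt_filterlim; apply (ex_derive_continuous q).
        now apply smooth_on_ex_derive with J.
    + exists (fun u v => Derive p u * q v); split.
      * apply sep_mult; [now apply smooth_on_Derive | exact Hq].
      * intros u v Hu Hv; apply (is_derive_scal_l p u (Derive p u) (q v)).
        apply Derive_correct; now apply smooth_on_ex_derive with I.
    + exists (fun u v => p u * Derive q v); split.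
      * apply sep_mult; [exact Hp | now apply smooth_on_Derive].
      * intros u v Hu Hv; apply (is_derive_scal q v (p u)).
        apply Derive_correct; now apply smooth_on_ex_derive with J.
  - split; [|split].
    + intros u v Hu Hv; apply continuity_2d_pt_plus; auto.
    + exists (fun u v => Fu u v + Gu u v); split; [now apply sep_plus|].
      intros u v Hu Hv; apply (is_derive_plus (fun s => F s v) (fun s => G s v));
        auto.
    + exists (fun u v => Fv u v + Gv u v); split; [now apply sep_plus|].
      intros u v Hu Hv; apply (is_derive_plus (F u) (G u)); auto.
Qed.

Lemma smooth_on2_separable_sum (I J : R -> Prop) (F : R -> R -> R) :
  is_open_interval I -> is_open_interval J ->
  separable_sum I J F -> smooth_on2 I J F.
Proof.
  intros HI HJ HF u v Hu Hv n; revert F HF u v Hu Hv.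
  assert (Hloc : forall (u v : R) (P : R -> R -> Prop), I u -> J v ->
            (forall x y, I x -> J y -> P x y) -> locally_2d P u v).
  { intros u v P Hu Hv HP.
    destruct (open_interval_locally I u HI Hu) as [d1 Hd1].
    destruct (open_interval_locally J v HJ Hv) as [d2 Hd2].
    assert (Hd : 0 < Rmin d1 d2).
    { apply Rmin_pos; [apply (cond_pos d1) | apply (cond_pos d2)]. }
    exists (mkposreal _ Hd); simpl; intros x y Hx Hy; apply HP.
    - apply Hd1, Rlt_le_trans with (1 := Hx), Rmin_l.
    - apply Hd2, Rlt_le_trans with (1 := Hy), Rmin_r. }
  induction n as [|n IH]; intros F HF u v Hu Hv;
    destruct (separable_sum_derivatives I J F HF)
      as [CF [[Fu [SFu DFu]] [Fv [SFv DFv]]]]; simpl.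
  - split; auto.
  - split; [auto|split; [|split; [|split]]].
    + exists (Fu u v); auto.
    + exists (Fv u v); auto.
    + apply ex_diff_n_ext_loc with Fu; [|now apply IH].
      apply Hloc; auto; intros x y Hx Hy; symmetry.
      apply is_derive_unique; auto.
    + apply ex_diff_n_ext_loc with Fv; [|now apply IH].
      apply Hloc; auto; intros x y Hx Hy; symmetry.
      apply is_derive_unique; auto.
Qed.

Lemma smooth_on2_ext (I J : R -> Prop) (F G : R -> R -> R) :
  (forall u v, G u v = F u v) -> smooth_on2 I J G -> smooth_on2 I J F.
Proof.
  intros HGF HG u v Hu Hv m; apply ex_diff_n_ext_loc with G; [|now apply HG].
  exists (mkposreal 1 Rlt_0_1); auto.
Qed.

(** * Meridians of constant axial trace *)

Lemma is_derive_value (h : R -> R) (x l l' : R) :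
  is_derive h x l -> l = l' -> is_derive h x l'.
Proof. now intros H <-. Qed.

Lemma is_derive_prod (p q : R -> R) (x p' q' : R) :
  is_derive p x p' -> is_derive q x q' ->
  is_derive (fun t => p t * q t) x (p' * q x + p x * q').
Proof.
  intros Hp Hq; apply (is_derive_mult p q x p' q' Hp Hq); exact Rmult_comm.
Qed.

Lemma is_derive_smooth (I : R -> Prop) (f : R -> R) (x : R) :
  smooth_on I f -> I x -> is_derive f x (Derive f x).
Proof.
  intros Hf Hx; apply Derive_correct; now apply smooth_on_ex_derive with I.
Qed.

Lemma is_derive_agree (I : R -> Prop) (p q : R -> R) (x p' q' : R) :
  is_open_interval I -> I x -> (forall t, I t -> p t = q t) ->
  is_derive p x p' -> is_derive q x q' -> p' = q'.
Proof.
  intros HI Hx Hpq Hp Hq.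
  rewrite <- (is_derive_unique _ _ _ Hp), <- (is_derive_unique _ _ _ Hq).
  apply Derive_ext_loc.
  generalize (open_interval_locally I x HI Hx); apply filter_imp; exact Hpq.
Qed.

Lemma is_sign_sqr (s : R) : is_sign s -> s * s = 1.
Proof. intros [-> | ->]; ring. Qed.

Lemma is_sign_mult (s s' : R) : is_sign s -> is_sign s' -> is_sign (s * s').
Proof. intros [-> | ->] [-> | ->]; unfold is_sign; lra. Qed.

(** The conditions on the meridian alone, separated from the curve [l]. *)
Record is_meridian (I : R -> Prop) (f g : R -> R) : Prop := {
  meridian_f_smooth : smooth_on I f;
  meridian_g_smooth : smooth_on I g;
  meridian_f_neq0 : forall u, I u -> f u <> 0;
  meridian_speed : forall u, I u -> Derive f u ^ 2 - Derive g u ^ 2 = 1;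
  meridian_g'_neq0 : forall u, I u -> Derive g u <> 0
}.

(** As [f'^2 - 1 = g'^2], this is [f * (f''/g' + g'/f)]: up to the factor
    [+-1/(2f)] it is the component of the mean curvature vector along the normal
    [g' l + f' axis], see [surface_mean_curvature]. *)
Definition axial_trace (f g : R -> R) (u : R) : R :=
  (f u * Derive (Derive f) u + Derive f u ^ 2 - 1) / Derive g u.

Lemma meridian_f'_neq0 (I : R -> Prop) (f g : R -> R) (u : R) :
  is_meridian I f g -> I u -> Derive f u <> 0.
Proof.
  intros HM Hu H0; generalize (meridian_speed I f g HM u Hu); rewrite H0; nra.
Qed.

(** Derivative of [f'^2 - g'^2 = 1]. *)
Lemma meridian_acceleration (I : R -> Prop) (f g : R -> R) (u : R) :
  is_open_interval I -> is_meridian I f g -> I u ->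
  Derive f u * Derive (Derive f) u = Derive g u * Derive (Derive g) u.
Proof.
  intros HI HM Hu.
  assert (Hf := is_derive_smooth I _ u (smooth_on_Derive I f (meridian_f_smooth I f g HM)) Hu).
  assert (Hg := is_derive_smooth I _ u (smooth_on_Derive I g (meridian_g_smooth I f g HM)) Hu).
  enough (H : Derive (Derive f) u * Derive f u + Derive f u * Derive (Derive f) u
     = plus (Derive (Derive g) u * Derive g u + Derive g u * Derive (Derive g) u) 0).
  { unfold plus in H; simpl in H; lra. }
  apply (is_derive_agree I (fun t => Derive f t * Derive f t)
           (fun t => plus (Derive g t * Derive g t) 1) u); auto.
  - intros t Ht; generalize (meridian_speed I f g HM t Ht).
    unfold plus; simpl; lra.
  - now apply is_derive_prod.
  - apply @is_derive_plus; [now apply is_derive_prod|].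
    exact (is_derive_const 1 u).
Qed.

(** The condition is a second order equation for [f]; it integrates once because
    [(f g')' = f' * axial_trace] along a meridian. *)
Lemma axial_trace_first_integral (I : R -> Prop) (f g : R -> R) (m : R) :
  is_open_interval I -> is_meridian I f g ->
  (forall u, I u -> axial_trace f g u = m) <->
  exists a, forall u, I u -> f u * Derive g u = m * f u + a.
Proof.
  intros HI HM.
  assert (Hd : forall u, I u -> is_derive (fun t => f t * Derive g t - m * f t) u
            (Derive f u * Derive g u + f u * Derive (Derive g) u - m * Derive f u)).
  { intros u Hu.
    assert (Df := is_derive_smooth I f u (meridian_f_smooth I f g HM) Hu).
    apply (is_derive_minus (fun t => f t * Derive g t) (fun t => m * f t)).
    - apply is_derive_prod; [exact Df|].
      apply (is_derive_smooth I); [|exact Hu].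
      apply smooth_on_Derive, (meridian_g_smooth I f g HM).
    - exact (is_derive_scal f u m _ Df). }
  assert (Hid : forall u, I u ->
            Derive g u * (Derive f u * Derive g u + f u * Derive (Derive g) u
                          - m * Derive f u)
            = Derive f u * Derive g u * (axial_trace f g u - m)).
  { intros u Hu; unfold axial_trace.
    assert (Hg' := meridian_g'_neq0 I f g HM u Hu).
    assert (Hacc := meridian_acceleration I f g u HI HM Hu).
    assert (Hsp := meridian_speed I f g HM u Hu).
    transitivity (Derive f u * (f u * Derive (Derive f) u + Derive f u ^ 2 - 1)
                  - m * Derive f u * Derive g u); [|field; exact Hg'].
    replace (f u * Derive (Derive f) u + Derive f u ^ 2 - 1)
      with (f u * Derive (Derive f) u + Derive g u ^ 2) by lra.
    transitivity (Derive f u * Derive g u ^ 2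
                  + f u * (Derive g u * Derive (Derive g) u)
                  - m * Derive f u * Derive g u); [ring|].
    rewrite <- Hacc; ring. }
  split.
  - intros Hm; destruct (open_interval_inhabited I HI) as [u0 Hu0].
    exists (f u0 * Derive g u0 - m * f u0); intros u Hu.
    enough (H : f u * Derive g u - m * f u = f u0 * Derive g u0 - m * f u0) by lra.
    apply (constant_of_derive_zero I (fun t => f t * Derive g t - m * f t)); auto.
    intros x Hx; apply (is_derive_value _ _ _ _ (Hd x Hx)).
    apply Rmult_eq_reg_l with (Derive g x); [|exact (meridian_g'_neq0 I f g HM x Hx)].
    rewrite Hid, Hm by assumption; ring.
  - intros [a Ha] u Hu.
    assert (H0 : Derive f u * Derive g u + f u * Derive (Derive g) u
                 - m * Derive f u = 0).
    { apply (is_derive_agree I (fun t => f t * Derive g t - m * f t) (fun _ => a) u);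
        auto.
      - intros t Ht; rewrite (Ha t Ht); ring.
      - exact (is_derive_const a u). }
    generalize (Hid u Hu); rewrite H0, Rmult_0_r; intros H; symmetry in H.
    destruct (Rmult_integral _ _ H) as [H' | H']; [exfalso|lra].
    destruct (Rmult_integral _ _ H') as [H'' | H''].
    + exact (meridian_f'_neq0 I f g u HM Hu H'').
    + exact (meridian_g'_neq0 I f g HM u Hu H'').
Qed.

Lemma sqrt_of_signed_square (s x y : R) :
  is_sign s -> 0 < s * x -> x ^ 2 = y -> x = s * sqrt y.
Proof.
  intros Hs Hx <-.
  replace (x ^ 2) with ((s * x) * (s * x)) by (destruct Hs; subst; ring).
  rewrite sqrt_square by lra; destruct Hs; subst; ring.
Qed.

(** With [X = u + a + s] and [s] the square root, [X' = X / s]; and [X <> 0]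
    because [(u + a)^2 - s^2 = a^2 - b > 0]. *)
Lemma is_derive_ln_abs_sqrt (a b u : R) :
  a ^ 2 - b > 0 -> u ^ 2 + 2 * a * u + b > 0 ->
  is_derive (fun u => ln (Rabs (u + a + sqrt (u ^ 2 + 2 * a * u + b)))) u
    (/ sqrt (u ^ 2 + 2 * a * u + b)).
Proof.
  intros Hab Hq.
  assert (Hs : 0 < sqrt (u ^ 2 + 2 * a * u + b)) by now apply sqrt_lt_R0.
  assert (Hs2 : sqrt (u ^ 2 + 2 * a * u + b) * sqrt (u ^ 2 + 2 * a * u + b)
                = u ^ 2 + 2 * a * u + b) by (apply sqrt_sqrt; lra).
  assert (HX : u + a + sqrt (u ^ 2 + 2 * a * u + b) <> 0).
  { intros H0; nra. }
  assert (HA : 0 < Rabs (u + a + sqrt (u ^ 2 + 2 * a * u + b)))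
    by now apply Rabs_pos_lt.
  auto_derive.
  - repeat split; auto; simpl in *; lra.
  - replace (u * (u * 1)) with (u ^ 2) by ring.
    set (s := sqrt _) in *.
    destruct (Rlt_or_le 0 (u + a + s)) as [Hp | Hn].
    + rewrite (Rabs_pos_eq (u + a + s)), sign_eq_1 by lra; field; lra.
    + rewrite (Rabs_left (u + a + s)), sign_eq_m1 by lra; field; lra.
Qed.

(** Vanishing of the axial trace means [(f f')' = 1], so [f^2] is a monic
    quadratic polynomial; its discriminant comes from the first integral
    [f g' = d], which also yields [g] by a quadrature. *)
Lemma axial_trace_zero_iff (I : R -> Prop) (f g : R -> R) :
  is_open_interval I -> is_meridian I f g ->
  (forall u, I u -> axial_trace f g u = 0) <->
  exists a b c s1 s2 : R,
      is_sign s1 /\ is_sign s2 /\ a ^ 2 - b > 0 /\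
      forall u, I u ->
        u ^ 2 + 2 * a * u + b > 0 /\
        f u = s1 * sqrt (u ^ 2 + 2 * a * u + b) /\
        g u = s2 * sqrt (a ^ 2 - b)
                * ln (Rabs (u + a + sqrt (u ^ 2 + 2 * a * u + b))) + c.
Proof.
  intros HI HM.
  assert (Df : forall u, I u -> is_derive f u (Derive f u)).
  { intros u Hu; exact (is_derive_smooth I f u (meridian_f_smooth I f g HM) Hu). }
  assert (Dff' : forall u, I u -> is_derive (fun t => f t * Derive f t) u
            (Derive f u * Derive f u + f u * Derive (Derive f) u)).
  { intros u Hu; apply is_derive_prod; auto.
    apply (is_derive_smooth I); [|exact Hu].
    apply smooth_on_Derive, (meridian_f_smooth I f g HM). }
  destruct (open_interval_inhabited I HI) as [u0 Hu0].
  split.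
  - intros Hmu.
    destruct (proj1 (axial_trace_first_integral I f g 0 HI HM) Hmu) as [d Hd].
    assert (Hfg : forall u, I u -> f u * Derive g u = d).
    { intros u Hu; rewrite (Hd u Hu); ring. }
    assert (Hff' : exists a, forall u, I u -> f u * Derive f u = u + a).
    { exists (f u0 * Derive f u0 - u0); intros u Hu.
      enough (H : f u * Derive f u - u = f u0 * Derive f u0 - u0) by lra.
      apply (constant_of_derive_zero I (fun t => f t * Derive f t - t)); auto.
      intros x Hx; eapply is_derive_value.
      - apply (is_derive_minus (fun t => f t * Derive f t) (fun t => t)).
        + exact (Dff' x Hx).
        + exact (is_derive_id x).
      - change (Derive f x * Derive f x + f x * Derive (Derive f) x - 1 = 0).
        generalize (Hmu x Hx); unfold axial_trace; intros H.
        assert (Hg' := meridian_g'_neq0 I f g HM x Hx).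
        apply Rmult_integral in H; destruct H as [H | H]; [lra|].
        elim (Rinv_neq_0_compat _ Hg' H). }
    destruct Hff' as [a Ha].
    assert (Hd2 : 0 < d ^ 2).
    { rewrite <- (Hfg u0 Hu0).
      assert (H : f u0 * Derive g u0 <> 0).
      { apply Rmult_integral_contrapositive_currified;
          [exact (meridian_f_neq0 I f g HM u0 Hu0)|
           exact (meridian_g'_neq0 I f g HM u0 Hu0)]. }
      nra. }
    assert (Hf2 : forall u, I u -> f u ^ 2 = u ^ 2 + 2 * a * u + (a ^ 2 - d ^ 2)).
    { intros u Hu; generalize (meridian_speed I f g HM u Hu) (Hfg u Hu) (Ha u Hu).
      intros H1 H2 H3.
      assert (H4 : (f u * Derive f u) ^ 2 - (f u * Derive g u) ^ 2 = f u ^ 2).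
      { replace ((f u * Derive f u) ^ 2 - (f u * Derive g u) ^ 2)
          with (f u ^ 2 * (Derive f u ^ 2 - Derive g u ^ 2)) by ring.
        rewrite H1; ring. }
      rewrite H2, H3 in H4; rewrite <- H4; ring. }
    assert (Hpos : forall u, I u -> u ^ 2 + 2 * a * u + (a ^ 2 - d ^ 2) > 0).
    { intros u Hu; rewrite <- (Hf2 u Hu).
      generalize (meridian_f_neq0 I f g HM u Hu); intros; nra. }
    destruct (constant_sign I f) as [s1 [Hs1 Hsf]]; auto.
    { intros x Hx; exists (Derive f x); auto. }
    { exact (meridian_f_neq0 I f g HM). }
    assert (Hsd : exists sd, is_sign sd /\ d = sd * sqrt (d ^ 2)).
    { destruct (Rlt_or_le 0 d) as [Hp | Hn].
      - exists 1; split; [now left|].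
        apply sqrt_of_signed_square; [now left | lra | ring].
      - exists (-1); split; [now right|].
        apply sqrt_of_signed_square; [now right | nra | ring]. }
    destruct Hsd as [sd [Hsd Hd']].
    assert (Hf : forall u, I u ->
              f u = s1 * sqrt (u ^ 2 + 2 * a * u + (a ^ 2 - d ^ 2))).
    { intros u Hu; apply sqrt_of_signed_square; auto. }
    set (L := fun u => s1 * sd * sqrt (a ^ 2 - (a ^ 2 - d ^ 2)) *
                ln (Rabs (u + a + sqrt (u ^ 2 + 2 * a * u + (a ^ 2 - d ^ 2))))).
    (* [g' = d / f] and [f = s1 sqrt q], so the sign in front of [|d|] is
       [s1 * sd]. *)
    exists a, (a ^ 2 - d ^ 2), (g u0 - L u0), s1, (s1 * sd).
    split; [exact Hs1|]; split; [now apply is_sign_mult|]; split; [lra|].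
    intros u Hu; split; [auto|]; split; [auto|].
    change (g u = L u + (g u0 - L u0)).
    enough (H : g u - L u = g u0 - L u0) by lra.
    apply (constant_of_derive_zero I (fun t => g t - L t)); auto.
    intros x Hx; eapply is_derive_value.
    + apply (is_derive_minus g L).
      * exact (is_derive_smooth I g x (meridian_g_smooth I f g HM) Hx).
      * unfold L; apply (is_derive_scal
          (fun u => ln (Rabs (u + a + sqrt (u ^ 2 + 2 * a * u + (a ^ 2 - d ^ 2)))))).
        apply is_derive_ln_abs_sqrt; [lra | auto].
    + change (Derive g x - s1 * sd * sqrt (a ^ 2 - (a ^ 2 - d ^ 2))
                * / sqrt (x ^ 2 + 2 * a * x + (a ^ 2 - d ^ 2)) = 0).
      replace (a ^ 2 - (a ^ 2 - d ^ 2)) with (d ^ 2) by ring.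
      assert (Hgx := Hfg x Hx); rewrite (Hf x Hx) in Hgx.
      assert (Hsq : 0 < sqrt (x ^ 2 + 2 * a * x + (a ^ 2 - d ^ 2)))
        by (apply sqrt_lt_R0, Hpos, Hx).
      set (s := sqrt (x ^ 2 + _ + _)) in *.
      assert (Hgx' : s * Derive g x = s1 * d).
      { rewrite <- Hgx; replace (s1 * (s1 * s * Derive g x))
          with (s1 * s1 * (s * Derive g x)) by ring.
        rewrite (is_sign_sqr s1 Hs1); ring. }
      apply Rmult_eq_reg_l with s; [|lra].
      transitivity (s * Derive g x - s1 * (sd * sqrt (d ^ 2))); [field; lra|].
      rewrite Hgx', <- Hd'; ring.
  - intros [a [b [c [s1 [s2 [Hs1 [_ [_ H]]]]]]]] u Hu.
    assert (Hf2 : forall u, I u -> f u * f u = u ^ 2 + 2 * a * u + b).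
    { intros x Hx; destruct (H x Hx) as [Hpos [-> _]].
      replace (s1 * sqrt (x ^ 2 + 2 * a * x + b) * (s1 * sqrt (x ^ 2 + 2 * a * x + b)))
        with (s1 * s1 * (sqrt (x ^ 2 + 2 * a * x + b) * sqrt (x ^ 2 + 2 * a * x + b)))
        by ring.
      rewrite (is_sign_sqr s1 Hs1), sqrt_sqrt; lra. }
    assert (Hff' : forall u, I u -> f u * Derive f u = u + a).
    { intros x Hx.
      enough (E : Derive f x * f x + f x * Derive f x = 2 * x + 2 * a) by lra.
      apply (is_derive_agree I (fun t => f t * f t) (fun t => t ^ 2 + 2 * a * t + b) x);
        auto.
      - apply is_derive_prod; auto.
      - auto_derive; [exact Logic.I | ring]. }
    assert (E : Derive f u * Derive f u + f u * Derive (Derive f) u = 1).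
    { apply (is_derive_agree I (fun t => f t * Derive f t) (fun t => t + a) u); auto.
      auto_derive; [exact Logic.I | ring]. }
    unfold axial_trace.
    replace (f u * Derive (Derive f) u + Derive f u ^ 2 - 1) with 0 by lra.
    unfold Rdiv; ring.
Qed.

(** The first integral [f g' = m f + a] and [f'^2 = 1 + g'^2] give
    [f^2 f'^2 = (m f + a)^2 + f^2], whose square root is taken with a constant
    sign. Conversely [f'] determines only [(f g')^2 = (c f + a)^2], so the axial
    trace is [c] up to a sign; this is harmless as only [c^2] is constrained. *)
Lemma axial_trace_nonzero_constant_iff (I : R -> Prop) (f g : R -> R) (k : R) :
  is_open_interval I -> is_meridian I f g ->
  (exists m, m <> 0 /\ m ^ 2 <> k ^ 2 /\ forall u, I u -> axial_trace f g u = m) <->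
  exists a c s s' : R,
    is_sign s /\ is_sign s' /\ c <> 0 /\ c ^ 2 <> k ^ 2 /\
    forall u, I u ->
      Derive f u = phi s a c (f u) /\
      Derive (fun x => s' * g x) u = sqrt ((Derive f u) ^ 2 - 1).
Proof.
  intros HI HM.
  assert (Hf0 := meridian_f_neq0 I f g HM).
  assert (Hf'0 : forall u, I u -> Derive f u <> 0).
  { intros u Hu; exact (meridian_f'_neq0 I f g u HM Hu). }
  assert (Hg'0 := meridian_g'_neq0 I f g HM).
  assert (Hsp := meridian_speed I f g HM).
  assert (Df : forall u, I u -> is_derive f u (Derive f u)).
  { intros u Hu; exact (is_derive_smooth I f u (meridian_f_smooth I f g HM) Hu). }
  assert (Dg' : forall u, I u -> is_derive (Derive g) u (Derive (Derive g) u)).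
  { intros u Hu; apply (is_derive_smooth I); [|exact Hu].
    apply smooth_on_Derive, (meridian_g_smooth I f g HM). }
  assert (Df' : forall u, I u -> is_derive (Derive f) u (Derive (Derive f) u)).
  { intros u Hu; apply (is_derive_smooth I); [|exact Hu].
    apply smooth_on_Derive, (meridian_f_smooth I f g HM). }
  split.
  - intros [m [Hm0 [Hmk Hm]]].
    destruct (proj1 (axial_trace_first_integral I f g m HI HM) Hm) as [a Ha].
    destruct (constant_sign I (fun t => f t * Derive f t))
      as [s [Hs Hsff']]; [exact HI | | |].
    { intros x Hx; eexists; apply is_derive_prod; auto. }
    { intros x Hx; apply Rmult_integral_contrapositive_currified; auto. }
    destruct (constant_sign I (Derive g)) as [s' [Hs' Hsg']]; auto.
    { intros x Hx; eexists; auto. }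
    exists a, m, s, s'; do 4 (split; [assumption|]); intros u Hu; split.
    + unfold phi.
      assert (E : f u * Derive f u = s * sqrt ((m * f u + a) ^ 2 + f u ^ 2)).
      { apply sqrt_of_signed_square; auto.
        rewrite <- (Ha u Hu).
        replace ((f u * Derive f u) ^ 2) with (f u ^ 2 * Derive f u ^ 2) by ring.
        replace (Derive f u ^ 2) with (1 + Derive g u ^ 2)
          by (generalize (Hsp u Hu); lra).
        ring. }
      apply Rmult_eq_reg_l with (f u); [|auto]; rewrite E; field; auto.
    + rewrite Derive_scal.
      replace (Derive f u ^ 2 - 1) with ((s' * Derive g u) * (s' * Derive g u)).
      * symmetry; apply sqrt_square; generalize (Hsg' u Hu); lra.
      * replace (s' * Derive g u * (s' * Derive g u))
          with (s' * s' * Derive g u ^ 2) by ring.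
        rewrite (is_sign_sqr s' Hs'); generalize (Hsp u Hu); lra.
  - intros [a [c [s [s' [Hs [_ [Hc0 [Hck H]]]]]]]].
    assert (Hsq : forall u, I u -> (f u * Derive g u) ^ 2 = (c * f u + a) ^ 2).
    { intros u Hu; destruct (H u Hu) as [Hphi _].
      assert (E : f u * Derive f u = s * sqrt ((c * f u + a) ^ 2 + f u ^ 2)).
      { rewrite Hphi; unfold phi; field; auto. }
      assert (E2 : (f u * Derive f u) ^ 2 = (c * f u + a) ^ 2 + f u ^ 2).
      { rewrite E.
        replace ((s * sqrt ((c * f u + a) ^ 2 + f u ^ 2)) ^ 2)
          with (s * s * (sqrt ((c * f u + a) ^ 2 + f u ^ 2)
                         * sqrt ((c * f u + a) ^ 2 + f u ^ 2))) by ring.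
        rewrite (is_sign_sqr s Hs), sqrt_sqrt; [ring|].
        apply Rplus_le_le_0_compat; apply pow2_ge_0. }
      replace ((f u * Derive g u) ^ 2) with (f u ^ 2 * Derive g u ^ 2) by ring.
      replace (Derive g u ^ 2) with (Derive f u ^ 2 - 1)
        by (generalize (Hsp u Hu); lra).
      replace (f u ^ 2 * (Derive f u ^ 2 - 1))
        with ((f u * Derive f u) ^ 2 - f u ^ 2) by ring.
      rewrite E2; ring. }
    assert (Hfg0 : forall u, I u -> f u * Derive g u <> 0).
    { intros u Hu; apply Rmult_integral_contrapositive_currified; auto. }
    destruct (constant_sign I (fun t => f t * Derive g t * (c * f t + a)))
      as [sg [Hsg Hpos]]; [exact HI | | |].
    { intros x Hx; eexists; apply is_derive_prod; [apply is_derive_prod; auto|].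
      apply (is_derive_plus (fun t => c * f t) (fun _ => a)).
      - exact (is_derive_scal f x c _ (Df x Hx)).
      - exact (is_derive_const a x). }
    { intros x Hx; apply Rmult_integral_contrapositive_currified; [auto|].
      intros E; generalize (Hsq x Hx) (Hfg0 x Hx); rewrite E; nra. }
    exists (sg * c); split; [|split].
    + destruct Hsg as [-> | ->]; lra.
    + replace ((sg * c) ^ 2) with (sg * sg * c ^ 2) by ring.
      now rewrite (is_sign_sqr sg Hsg), Rmult_1_l.
    + apply axial_trace_first_integral; auto.
      (* [sg] is the sign for which [f g' = sg (c f + a)], by continuity. *)
      exists (sg * a); intros u Hu.
      generalize (Hsq u Hu) (Hpos u Hu); intros E P.
      assert (E' : (f u * Derive g u - (c * f u + a))
                   * (f u * Derive g u + (c * f u + a)) = 0) by nra.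
      destruct (Rmult_integral _ _ E') as [E1 | E1];
        destruct Hsg as [-> | ->]; nra.
Qed.

(** * Vectors *)

Lemma E4_ext (p q : E4) :
  x1 p = x1 q -> x2 p = x2 q -> x3 p = x3 q -> x4 p = x4 q -> p = q.
Proof.
  destruct p as [[[p1 p2] p3] p4]; destruct q as [[[q1 q2] q3] q4].
  unfold x1, x2, x3, x4; simpl; intros; subst; reflexivity.
Qed.

Ltac concrete_coords :=
  unfold inner, minus, e1, e2, e3, e4, mkE4, x1, x2, x3, x4;
  repeat (progress (unfold plus, opp, scal, mult, zero; simpl)).

Ltac coords :=
  repeat match goal with
    | |- context [?c ?s ?r] =>
        is_var c; is_var s; is_var r;
        match type of (c s r) with E4 => generalize (c s r); intro end
    | |- context [?c ?s] =>
        is_var c; is_var s;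
        match type of (c s) with E4 => generalize (c s); intro end
    end;
  repeat match goal with p : E4 |- _ => destruct p as [[[? ?] ?] ?] end;
  concrete_coords.

Lemma inner_sym (p q : E4) : inner p q = inner q p.
Proof. unfold inner; ring. Qed.

Lemma inner_plus_l (p q r : E4) : inner (plus p q) r = inner p r + inner q r.
Proof. unfold inner; coords; ring. Qed.

Lemma inner_scal_l (a : R) (p r : E4) : inner (scal a p) r = a * inner p r.
Proof. unfold inner; coords; ring. Qed.

Lemma inner_plus_r (p q r : E4) : inner r (plus p q) = inner r p + inner r q.
Proof. unfold inner; coords; ring. Qed.

Lemma inner_scal_r (a : R) (p r : E4) : inner r (scal a p) = a * inner r p.
Proof. unfold inner; coords; ring. Qed.

Lemma inner_zero_l (r : E4) : inner zero r = 0.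
Proof. unfold inner; coords; ring. Qed.

Lemma inner_zero_r (r : E4) : inner r zero = 0.
Proof. rewrite inner_sym; apply inner_zero_l. Qed.

Ltac expand_inner :=
  rewrite ?inner_plus_l, ?inner_scal_l, ?inner_plus_r, ?inner_scal_r,
    ?inner_plus_l, ?inner_scal_l, ?inner_plus_r, ?inner_scal_r.

Definition is_deriveE (c : R -> E4) (t : R) (d : E4) : Prop :=
  is_derive (fun s => x1 (c s)) t (x1 d) /\ is_derive (fun s => x2 (c s)) t (x2 d) /\
  is_derive (fun s => x3 (c s)) t (x3 d) /\ is_derive (fun s => x4 (c s)) t (x4 d).

Lemma is_deriveE_unique (c : R -> E4) (t : R) (d : E4) :
  is_deriveE c t d -> DeriveE c t = d.
Proof.
  intros [H1 [H2 [H3 H4]]]; unfold DeriveE.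
  now apply E4_ext; apply is_derive_unique.
Qed.

Lemma is_deriveE_ext_loc (c c' : R -> E4) (t : R) (d : E4) :
  locally t (fun s => c s = c' s) -> is_deriveE c t d -> is_deriveE c' t d.
Proof.
  intros Hl [H1 [H2 [H3 H4]]].
  split; [|split; [|split]].
  - revert H1; apply is_derive_ext_loc, filter_imp with (2 := Hl); now intros s ->.
  - revert H2; apply is_derive_ext_loc, filter_imp with (2 := Hl); now intros s ->.
  - revert H3; apply is_derive_ext_loc, filter_imp with (2 := Hl); now intros s ->.
  - revert H4; apply is_derive_ext_loc, filter_imp with (2 := Hl); now intros s ->.
Qed.

Lemma is_deriveE_plus (c c' : R -> E4) (t : R) (d d' : E4) :
  is_deriveE c t d -> is_deriveE c' t d' ->
  is_deriveE (fun s => plus (c s) (c' s)) t (plus d d').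
Proof.
  intros [H1 [H2 [H3 H4]]] [H1' [H2' [H3' H4']]].
  split; [|split; [|split]].
  - exact (is_derive_plus _ _ _ _ _ H1 H1').
  - exact (is_derive_plus _ _ _ _ _ H2 H2').
  - exact (is_derive_plus _ _ _ _ _ H3 H3').
  - exact (is_derive_plus _ _ _ _ _ H4 H4').
Qed.

Lemma is_deriveE_scal (h : R -> R) (c : R -> E4) (t h' : R) (d : E4) :
  is_derive h t h' -> is_deriveE c t d ->
  is_deriveE (fun s => scal (h s) (c s)) t (plus (scal h' (c t)) (scal (h t) d)).
Proof.
  intros Hh [H1 [H2 [H3 H4]]].
  split; [|split; [|split]].
  - exact (is_derive_prod _ _ _ _ _ Hh H1).
  - exact (is_derive_prod _ _ _ _ _ Hh H2).
  - exact (is_derive_prod _ _ _ _ _ Hh H3).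
  - exact (is_derive_prod _ _ _ _ _ Hh H4).
Qed.

Lemma is_deriveE_const (p : E4) (t : R) : is_deriveE (fun _ => p) t zero.
Proof. split; [|split; [|split]]; apply @is_derive_const. Qed.

Lemma is_deriveE_value (c : R -> E4) (t : R) (d d' : E4) :
  is_deriveE c t d -> d = d' -> is_deriveE c t d'.
Proof. now intros H <-. Qed.

Lemma DeriveE_const (p : E4) (t : R) : DeriveE (fun _ => p) t = zero.
Proof. apply is_deriveE_unique, is_deriveE_const. Qed.

Lemma is_deriveE_varying_scalars (p q : R -> R) (u p' q' : R) (a b : E4) :
  is_derive p u p' -> is_derive q u q' ->
  is_deriveE (fun s => plus (scal (p s) a) (scal (q s) b)) u
    (plus (scal p' a) (scal q' b)).
Proof.
  intros Hp Hq; eapply is_deriveE_value.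
  - apply is_deriveE_plus; apply is_deriveE_scal;
      [exact Hp | apply is_deriveE_const | exact Hq | apply is_deriveE_const].
  - apply E4_ext; coords; ring.
Qed.

Lemma is_deriveE_varying_vectors (p q v : R) (a b : R -> E4) (a' b' : E4) :
  is_deriveE a v a' -> is_deriveE b v b' ->
  is_deriveE (fun s => plus (scal p (a s)) (scal q (b s))) v
    (plus (scal p a') (scal q b')).
Proof.
  intros Ha Hb; eapply is_deriveE_value.
  - apply is_deriveE_plus; apply is_deriveE_scal;
      [apply @is_derive_const | exact Ha | apply @is_derive_const | exact Hb].
  - change (@zero R_AbsRing) with 0; apply E4_ext; coords.
    all: change (@zero R_NormedModule) with 0; ring.
Qed.

Lemma is_derive_inner (c c' : R -> E4) (t : R) (d d' : E4) :
  is_deriveE c t d -> is_deriveE c' t d' ->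
  is_derive (fun s => inner (c s) (c' s)) t (inner d (c' t) + inner (c t) d').
Proof.
  intros [H1 [H2 [H3 H4]]] [H1' [H2' [H3' H4']]].
  eapply is_derive_value.
  - apply @is_derive_minus; [apply @is_derive_minus; [apply @is_derive_plus|]|].
    + exact (is_derive_prod _ _ _ _ _ H1 H1').
    + exact (is_derive_prod _ _ _ _ _ H2 H2').
    + exact (is_derive_prod _ _ _ _ _ H3 H3').
    + exact (is_derive_prod _ _ _ _ _ H4 H4').
  - unfold inner, minus, plus, opp; simpl; ring.
Qed.

Lemma smooth_curve_is_deriveE (J : R -> Prop) (c : R -> E4) (v : R) :
  smooth_curve_on J c -> J v -> is_deriveE c v (DeriveE c v).
Proof.
  intros [H1 [H2 [H3 H4]]] Hv.
  split; [|split; [|split]]; now apply (is_derive_smooth J).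
Qed.

Lemma smooth_curve_DeriveE (J : R -> Prop) (c : R -> E4) :
  smooth_curve_on J c -> smooth_curve_on J (DeriveE c).
Proof.
  intros [H1 [H2 [H3 H4]]].
  split; [|split; [|split]]; apply smooth_on_Derive; assumption.
Qed.

Lemma smooth_curve_const (J : R -> Prop) (p : E4) :
  is_open_interval J -> smooth_curve_on J (fun _ => p).
Proof.
  intros HJ; split; [|split; [|split]]; now apply smooth_on_const.
Qed.

(** The source of all relations between a frame and its derivatives. *)
Lemma inner_constant_derive (J : R -> Prop) (c c' : R -> E4) (v a : R) :
  is_open_interval J -> smooth_curve_on J c -> smooth_curve_on J c' ->
  (forall s, J s -> inner (c s) (c' s) = a) -> J v ->
  inner (DeriveE c v) (c' v) + inner (c v) (DeriveE c' v) = 0.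
Proof.
  intros HJ Hc Hc' Ha Hv.
  apply (is_derive_agree J (fun s => inner (c s) (c' s)) (fun _ => a) v); auto.
  - apply is_derive_inner; now apply (smooth_curve_is_deriveE J).
  - exact (is_derive_const a v).
Qed.

(** * Orthonormal frames of signature (e, -e, e, -e) *)

(** That the four vectors span is recorded as the expansion of an arbitrary
    vector, the form from which normal parts are read off. *)
Record neutral_frame (e : R) (a b c d : E4) : Prop := {
  frame_sign : is_sign e;
  frame_aa : inner a a = e;
  frame_bb : inner b b = - e;
  frame_cc : inner c c = e;
  frame_dd : inner d d = - e;
  frame_ab : inner a b = 0;
  frame_ac : inner a c = 0;
  frame_ad : inner a d = 0;
  frame_bc : inner b c = 0;
  frame_bd : inner b d = 0;
  frame_cd : inner c d = 0;
  frame_expand : forall w, w =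
    plus (minus (scal (e * inner w a) a) (scal (e * inner w b) b))
         (minus (scal (e * inner w c) c) (scal (e * inner w d) d))
}.

(** The Gram determinant is [-r], and it is also [-D^2] where [D] is the
    determinant of the three vectors. Hence [r = D^2] is positive and [D <> 0],
    and by Cramer's rule the error of the expansion, which is orthogonal to all
    three vectors, vanishes. *)
Lemma lorentz_triple_expand (a1 a2 a3 b1 b2 b3 c1 c2 c3 r : R) :
  a1 * a1 + a2 * a2 - a3 * a3 = 1 -> b1 * b1 + b2 * b2 - b3 * b3 = -1 ->
  c1 * c1 + c2 * c2 - c3 * c3 = r -> (r = 1 \/ r = -1) ->
  a1 * b1 + a2 * b2 - a3 * b3 = 0 -> a1 * c1 + a2 * c2 - a3 * c3 = 0 ->
  b1 * c1 + b2 * c2 - b3 * c3 = 0 ->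
  r = 1 /\
  forall w1 w2 w3,
    let wa := w1 * a1 + w2 * a2 - w3 * a3 in
    let wb := w1 * b1 + w2 * b2 - w3 * b3 in
    let wc := w1 * c1 + w2 * c2 - w3 * c3 in
    w1 = wa * a1 - wb * b1 + wc * c1 /\
    w2 = wa * a2 - wb * b2 + wc * c2 /\
    w3 = wa * a3 - wb * b3 + wc * c3.
Proof.
  intros Haa Hbb Hcc Hr Hab Hac Hbc.
  set (D := a1 * (b2 * c3 - b3 * c2) - a2 * (b1 * c3 - b3 * c1)
            + a3 * (b1 * c2 - b2 * c1)).
  assert (HD : D * D = r).
  { assert (G : - (D * D) =
      (a1 * a1 + a2 * a2 - a3 * a3) *
        ((b1 * b1 + b2 * b2 - b3 * b3) * (c1 * c1 + c2 * c2 - c3 * c3)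
         - (b1 * c1 + b2 * c2 - b3 * c3) * (b1 * c1 + b2 * c2 - b3 * c3))
      - (a1 * b1 + a2 * b2 - a3 * b3) *
        ((a1 * b1 + a2 * b2 - a3 * b3) * (c1 * c1 + c2 * c2 - c3 * c3)
         - (b1 * c1 + b2 * c2 - b3 * c3) * (a1 * c1 + a2 * c2 - a3 * c3))
      + (a1 * c1 + a2 * c2 - a3 * c3) *
        ((a1 * b1 + a2 * b2 - a3 * b3) * (b1 * c1 + b2 * c2 - b3 * c3)
         - (b1 * b1 + b2 * b2 - b3 * b3) * (a1 * c1 + a2 * c2 - a3 * c3)))
      by (unfold D; ring).
    rewrite Haa, Hbb, Hcc, Hab, Hac, Hbc in G; lra. }
  assert (Hr1 : r = 1) by (destruct Hr; [assumption | nra]).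
  split; [exact Hr1|]; intros w1 w2 w3 wa wb wc.
  assert (HD0 : D <> 0) by (intros H0; rewrite H0 in HD; lra).
  set (y1 := w1 - (wa * a1 - wb * b1 + wc * c1)).
  set (y2 := w2 - (wa * a2 - wb * b2 + wc * c2)).
  set (y3 := w3 - (wa * a3 - wb * b3 + wc * c3)).
  assert (Ya : y1 * a1 + y2 * a2 - y3 * a3 = 0).
  { transitivity (wa - wa * (a1 * a1 + a2 * a2 - a3 * a3)
      + wb * (a1 * b1 + a2 * b2 - a3 * b3) - wc * (a1 * c1 + a2 * c2 - a3 * c3)).
    - unfold y1, y2, y3, wa; ring.
    - rewrite Haa, Hab, Hac; ring. }
  assert (Yb : y1 * b1 + y2 * b2 - y3 * b3 = 0).
  { transitivity (wb - wa * (a1 * b1 + a2 * b2 - a3 * b3)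
      + wb * (b1 * b1 + b2 * b2 - b3 * b3) - wc * (b1 * c1 + b2 * c2 - b3 * c3)).
    - unfold y1, y2, y3, wb; ring.
    - rewrite Hbb, Hab, Hbc; ring. }
  assert (Yc : y1 * c1 + y2 * c2 - y3 * c3 = 0).
  { transitivity (wc - wa * (a1 * c1 + a2 * c2 - a3 * c3)
      + wb * (b1 * c1 + b2 * c2 - b3 * c3) - wc * (c1 * c1 + c2 * c2 - c3 * c3)).
    - unfold y1, y2, y3, wc; ring.
    - rewrite Hcc, Hac, Hbc, Hr1; ring. }
  assert (E1 : D * y1 = 0).
  { transitivity ((y1 * a1 + y2 * a2 - y3 * a3) * (b2 * c3 - b3 * c2)
      - (y1 * b1 + y2 * b2 - y3 * b3) * (a2 * c3 - a3 * c2)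
      + (y1 * c1 + y2 * c2 - y3 * c3) * (a2 * b3 - a3 * b2)).
    - unfold D; ring.
    - rewrite Ya, Yb, Yc; ring. }
  assert (E2 : D * y2 = 0).
  { transitivity (- (y1 * a1 + y2 * a2 - y3 * a3) * (b1 * c3 - b3 * c1)
      + (y1 * b1 + y2 * b2 - y3 * b3) * (a1 * c3 - a3 * c1)
      - (y1 * c1 + y2 * c2 - y3 * c3) * (a1 * b3 - a3 * b1)).
    - unfold D; ring.
    - rewrite Ya, Yb, Yc; ring. }
  assert (E3 : D * y3 = 0).
  { transitivity (- (y1 * a1 + y2 * a2 - y3 * a3) * (b1 * c2 - b2 * c1)
      + (y1 * b1 + y2 * b2 - y3 * b3) * (a1 * c2 - a2 * c1)
      - (y1 * c1 + y2 * c2 - y3 * c3) * (a1 * b2 - a2 * b1)).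
    - unfold D; ring.
    - rewrite Ya, Yb, Yc; ring. }
  destruct (Rmult_integral _ _ E1) as [H | H1]; [easy|].
  destruct (Rmult_integral _ _ E2) as [H | H2]; [easy|].
  destruct (Rmult_integral _ _ E3) as [H | H3]; [easy|].
  unfold y1, y2, y3 in *; repeat split; lra.
Qed.

(** [(p, q; q, p)] with [p^2 - q^2 = 1] preserves the indefinite form on the plane
    of [a] and [d]; it leads from [(l, t, n, axis)] to the frame adapted to the
    surface. *)
Lemma neutral_frame_boost (e p q : R) (a b c d : E4) :
  p ^ 2 - q ^ 2 = 1 -> neutral_frame e a b c d ->
  neutral_frame e (plus (scal p a) (scal q d)) b c (plus (scal q a) (scal p d)).
Proof.
  intros Hpq [He Haa Hbb Hcc Hdd Hab Hac Had Hbc Hbd Hcd Hw].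
  assert (Hda : inner d a = 0) by now rewrite inner_sym.
  assert (Hba : inner b a = 0) by now rewrite inner_sym.
  assert (Hca : inner c a = 0) by now rewrite inner_sym.
  assert (Hdb : inner d b = 0) by now rewrite inner_sym.
  assert (Hdc : inner d c = 0) by now rewrite inner_sym.
  split; try assumption; expand_inner;
    rewrite ?Haa, ?Hdd, ?Had, ?Hda, ?Hab, ?Hac, ?Hba, ?Hca, ?Hbd, ?Hcd, ?Hdb, ?Hdc;
    try ring.
  - transitivity (e * (p ^ 2 - q ^ 2)); [ring | rewrite Hpq; ring].
  - transitivity (- e * (p ^ 2 - q ^ 2)); [ring | rewrite Hpq; ring].
  - intros w; rewrite (Hw w) at 1; expand_inner.
    generalize (inner w a) (inner w b) (inner w c) (inner w d).
    intros wa wb wc wd.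
    assert (H : forall s t r y : R,
      (e * wa * s - r) + (y - e * wd * t)
      = (e * (p * wa + q * wd) * (p * s + q * t) - r)
        + (y - e * (q * wa + p * wd) * (q * s + p * t))).
    { intros s t r y.
      transitivity ((p ^ 2 - q ^ 2) * (e * wa * s - e * wd * t) - r + y); [|ring].
      rewrite Hpq; ring. }
    apply E4_ext; coords; apply H.
Qed.

(** The common value of [<l, l>], [-<l', l'>], [<n, n>] and [-<axis, axis>]. With
    it the two kinds of surfaces are treated at once: they differ by the sign of
    the metric only. *)
Definition base_sign (K : meridian_kind) : R := - speed_value K.

Lemma in_curve_space_iff (K : meridian_kind) (p : E4) :
  in_curve_space K p <-> inner p (axis K) = 0.
Proof.
  destruct K; unfold inner, in_curve_space, axis; split.
  - intros [r1 [r2 [r3 ->]]]; concrete_coords; ring.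
  - intros H; exists (x1 p), (x2 p), (x3 p).
    apply E4_ext; revert H; concrete_coords; lra.
  - intros [r1 [r2 [r3 ->]]]; concrete_coords; ring.
  - intros H; exists (x2 p), (x3 p), (x4 p).
    apply E4_ext; revert H; concrete_coords; lra.
Qed.

(** The three-dimensional space containing the curve has signature [(2, 1)] for
    [Mb] and [(1, 2)] for [Ma]; the second case reduces to the first by a sign
    change of the metric and the order [x3, x4, x2] of the coordinates. *)
Lemma ambient_frame (K : meridian_kind) (a b c : E4) :
  inner a (axis K) = 0 -> inner b (axis K) = 0 -> inner c (axis K) = 0 ->
  inner a a = base_sign K -> inner b b = - base_sign K ->
  is_orthonormal3 a b c -> neutral_frame (base_sign K) a b c (axis K).
Proof.
  intros Ha Hb Hc Haa Hbb [_ [_ [Hcc [Hab [Hac Hbc]]]]].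
  destruct a as [[[a1 a2] a3] a4]; destruct b as [[[b1 b2] b3] b4];
    destruct c as [[[c1 c2] c3] c4].
  destruct K; unfold base_sign, speed_value, is_unit_vector, inner, axis, e1, e4,
    mkE4, x1, x2, x3, x4 in *; simpl in *.
  - assert (a4 = 0) by lra; assert (b4 = 0) by lra; assert (c4 = 0) by lra; subst.
    destruct (lorentz_triple_expand a1 a2 a3 b1 b2 b3 c1 c2 c3
      (c1 * c1 + c2 * c2 - c3 * c3)) as [Hr Hw]; try lra.
    split; unfold is_sign, inner; unfold x1, x2, x3, x4; simpl; try lra.
    intros [[[w1 w2] w3] w4]; destruct (Hw w1 w2 w3) as [H1 [H2 H3]].
    apply E4_ext; concrete_coords;
      [etransitivity; [exact H1|] | etransitivity; [exact H2|]
      | etransitivity; [exact H3|] |]; replace (- (-1)) with 1 by ring; rewrite !Rmult_0_r; ring.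
  - assert (a1 = 0) by lra; assert (b1 = 0) by lra; assert (c1 = 0) by lra; subst.
    destruct (lorentz_triple_expand a3 a4 a2 b3 b4 b2 c3 c4 c2
      (c3 * c3 + c4 * c4 - c2 * c2)) as [Hr Hw]; try lra.
    split; unfold is_sign, inner; unfold x1, x2, x3, x4; simpl; try lra.
    intros [[[w1 w2] w3] w4]; destruct (Hw w3 w4 w2) as [H1 [H2 H3]].
    apply E4_ext; concrete_coords;
      [| etransitivity; [exact H3|] | etransitivity; [exact H1|]
      | etransitivity; [exact H2|]]; rewrite !Rmult_0_r; ring.
Qed.

(** * Meridian surfaces *)

(** If the first two vectors of a frame span the tangent plane, the normal part
    is the rest of the expansion in the frame. *)
Lemma normal_part_frame (z : R -> R -> E4) (u v e r : R) (a b c d w : E4) :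
  neutral_frame e a b c d -> partial_u z u v = a -> partial_v z u v = scal r b ->
  r <> 0 ->
  normal_part z u v w = minus (scal (e * inner w c) c) (scal (e * inner w d) d).
Proof.
  intros HF Hzu Hzv Hr.
  unfold normal_part, tangent_part, ffdet, ffE, ffF, ffG; rewrite Hzu, Hzv.
  destruct HF as [He Haa Hbb Hcc Hdd Hab Hac Had Hbc Hbd Hcd Hw].
  expand_inner; rewrite Haa, Hbb, Hab.
  assert (He2 := is_sign_sqr e He).
  replace ((r * (r * - e) * inner w a - r * 0 * (r * inner w b))
           / (e * (r * (r * - e)) - (r * 0) ^ 2)) with (e * inner w a).
  2:{ replace (e * (r * (r * - e)) - (r * 0) ^ 2) with (- (r * r) * (e * e)) by ring.
      rewrite He2; field; exact Hr. }
  replace ((e * (r * inner w b) - r * 0 * inner w a)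
           / (e * (r * (r * - e)) - (r * 0) ^ 2)) with (- (e * inner w b) / r).
  2:{ replace (e * (r * (r * - e)) - (r * 0) ^ 2) with (- (r * r) * (e * e)) by ring.
      rewrite He2; field; exact Hr. }
  rewrite (Hw w) at 1.
  generalize (inner w a) (inner w b) (inner w c) (inner w d).
  intros wa wb wc wd; apply E4_ext; coords; field; exact Hr.
Qed.

Section MeridianSurface.

Variables (K : meridian_kind) (I J : R -> Prop) (f g w1 w2 : R -> R) (n : R -> E4).
Hypothesis hI : is_open_interval I.
Hypothesis hJ : is_open_interval J.
Hypothesis hM : is_meridian_surface K I J f g w1 w2.
Hypothesis hg : forall u, I u -> Derive g u <> 0.
Hypothesis hn : is_frame_normal K J w1 w2 n.

Let l := curve K w1 w2.
Let t := DeriveE l.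
Let A := axis K.
Let e := base_sign K.
Let kappa := spherical_curvature K w1 w2 n.
Let z := meridian_surface K f g w1 w2.
Let mu := axial_trace f g.

Let N (u v : R) : E4 := plus (scal (Derive g u) (l v)) (scal (Derive f u) A).

Lemma surface_meridian : is_meridian I f g.
Proof.
  destruct hM; split; assumption.
Qed.

Lemma curve_smooth : smooth_curve_on J l.
Proof.
  assert (S1 := mer_w1_smooth _ _ _ _ _ _ _ hM).
  assert (S2 := mer_w2_smooth _ _ _ _ _ _ _ hM).
  assert (HC : smooth_on J (fun v => cosh (w1 v) * cos (w2 v))).
  { apply smooth_on_elementary; [exact hJ|].
    apply (gen_mult _ (fun v => cosh (w1 v)) (fun v => cos (w2 v))); apply gen_base.
    - now apply elem_cosh.
    - now apply elem_cos. }
  assert (HS : smooth_on J (fun v => cosh (w1 v) * sin (w2 v))).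
  { apply smooth_on_elementary; [exact hJ|].
    apply (gen_mult _ (fun v => cosh (w1 v)) (fun v => sin (w2 v))); apply gen_base.
    - now apply elem_cosh.
    - now apply elem_sin. }
  assert (Hs : smooth_on J (fun v => sinh (w1 v))).
  { apply smooth_on_elementary; [exact hJ|]; now apply gen_base, elem_sinh. }
  assert (H0 : smooth_on J (fun _ => 0)) by now apply smooth_on_const.
  unfold l, curve; destruct K; split; [|split; [|split]| |split; [|split]];
    assumption.
Qed.

Lemma curve_norm (v : R) : inner (l v) (l v) = e.
Proof.
  assert (HC : cosh (w1 v) * cosh (w1 v) - sinh (w1 v) * sinh (w1 v) = 1).
  { unfold cosh, sinh.
    transitivity (exp (w1 v) * exp (- w1 v)); [field|].
    rewrite <- exp_plus, Rplus_opp_r; apply exp_0. }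
  assert (HT : sin (w2 v) * sin (w2 v) + cos (w2 v) * cos (w2 v) = 1).
  { exact (sin2_cos2 (w2 v)). }
  assert (HCT : cosh (w1 v) * cos (w2 v) * (cosh (w1 v) * cos (w2 v))
     + cosh (w1 v) * sin (w2 v) * (cosh (w1 v) * sin (w2 v))
     = cosh (w1 v) * cosh (w1 v)).
  { transitivity (cosh (w1 v) * cosh (w1 v) *
      (sin (w2 v) * sin (w2 v) + cos (w2 v) * cos (w2 v))); [ring|].
    rewrite HT; ring. }
  unfold l, e, base_sign, speed_value, inner, curve, mkE4; destruct K;
    unfold x1, x2, x3, x4; simpl; lra.
Qed.

Lemma curve_axis (v : R) : inner (l v) A = 0.
Proof.
  unfold l, A; apply in_curve_space_iff.
  destruct K; unfold in_curve_space, curve; do 3 eexists;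
    apply E4_ext; concrete_coords; ring_simplify; reflexivity.
Qed.

Lemma tangent_axis (v : R) : J v -> inner (t v) A = 0.
Proof.
  intros Hv.
  generalize (inner_constant_derive J l (fun _ => A) v 0 hJ curve_smooth
                (smooth_curve_const J A hJ) (fun s _ => curve_axis s) Hv).
  rewrite DeriveE_const, inner_zero_r; unfold t; lra.
Qed.

Lemma moving_frame (v : R) : J v -> neutral_frame e (l v) (t v) (n v) A.
Proof.
  intros Hv; destruct (proj2 hn v Hv) as [Hin Hon].
  apply ambient_frame; [apply curve_axis | now apply tangent_axis
    | now apply in_curve_space_iff | apply curve_norm | | exact Hon].
  transitivity (speed_value K); [|unfold base_sign; ring].
  exact (mer_unit_speed _ _ _ _ _ _ _ hM v Hv).
Qed.

(** The coefficients in the moving frame come from differentiating the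
    orthonormality relations; for instance [<t', l> = - <t, t> = e]. *)
Lemma frenet_tangent (v : R) : J v ->
  DeriveE t v = plus (l v) (scal (e * kappa v) (n v)).
Proof.
  intros Hv.
  assert (HF := moving_frame v Hv).
  assert (Sl := curve_smooth).
  assert (St := smooth_curve_DeriveE J l Sl).
  assert (H1 := inner_constant_derive J t l v 0 hJ St Sl
    (fun s Hs => eq_trans (inner_sym _ _) (frame_ab _ _ _ _ _ (moving_frame s Hs))) Hv).
  assert (H2 := inner_constant_derive J t t v (- e) hJ St St
    (fun s Hs => frame_bb _ _ _ _ _ (moving_frame s Hs)) Hv).
  assert (H3 := inner_constant_derive J t (fun _ => A) v 0 hJ St
    (smooth_curve_const J A hJ) tangent_axis Hv).
  rewrite DeriveE_const, inner_zero_r in H3.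
  rewrite (inner_sym (t v)) in H2.
  change (DeriveE l v) with (t v) in H1.
  rewrite (frame_bb _ _ _ _ _ HF) in H1.
  assert (H4 : inner (DeriveE t v) (n v) = kappa v) by reflexivity.
  assert (He := is_sign_sqr e (frame_sign _ _ _ _ _ HF)).
  rewrite (frame_expand _ _ _ _ _ HF (DeriveE t v)) at 1.
  rewrite H4.
  replace (inner (DeriveE t v) (l v)) with e by lra.
  replace (inner (DeriveE t v) (t v)) with 0 by lra.
  replace (inner (DeriveE t v) A) with 0 by lra.
  rewrite He; clear.
  generalize (l v) (t v) (n v) A (kappa v) e; intros a b c d k e'.
  apply E4_ext; coords; ring.
Qed.

Lemma frenet_normal (v : R) : J v ->
  DeriveE n v = scal (e * kappa v) (t v).
Proof.
  intros Hv.
  assert (HF := moving_frame v Hv).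
  assert (Sl := curve_smooth).
  assert (St := smooth_curve_DeriveE J l Sl).
  assert (Sn := proj1 hn).
  assert (H1 := inner_constant_derive J n l v 0 hJ Sn Sl
    (fun s Hs => eq_trans (inner_sym _ _) (frame_ac _ _ _ _ _ (moving_frame s Hs))) Hv).
  assert (H2 := inner_constant_derive J n t v 0 hJ Sn St
    (fun s Hs => eq_trans (inner_sym _ _) (frame_bc _ _ _ _ _ (moving_frame s Hs))) Hv).
  assert (H3 := inner_constant_derive J n n v e hJ Sn Sn
    (fun s Hs => frame_cc _ _ _ _ _ (moving_frame s Hs)) Hv).
  assert (H4 := inner_constant_derive J n (fun _ => A) v 0 hJ Sn
    (smooth_curve_const J A hJ)
    (fun s Hs => frame_cd _ _ _ _ _ (moving_frame s Hs)) Hv).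
  rewrite DeriveE_const, inner_zero_r in H4.
  change (DeriveE l v) with (t v) in H1.
  rewrite (inner_sym (n v) (t v)), (frame_bc _ _ _ _ _ HF) in H1.
  rewrite (inner_sym (n v) (DeriveE t v)) in H2.
  change (inner (DeriveE t v) (n v)) with (kappa v) in H2.
  rewrite (inner_sym (n v) (DeriveE n v)) in H3.
  rewrite (frame_expand _ _ _ _ _ HF (DeriveE n v)) at 1.
  replace (inner (DeriveE n v) (l v)) with 0 by lra.
  replace (inner (DeriveE n v) (t v)) with (- kappa v) by lra.
  replace (inner (DeriveE n v) (n v)) with 0 by lra.
  replace (inner (DeriveE n v) A) with 0 by lra.
  clear.
  generalize (l v) (t v) (n v) A (kappa v) e; intros a b c d k e'.
  apply E4_ext; coords; ring.
Qed.

Lemma curve_is_deriveE (v : R) : J v -> is_deriveE l v (t v).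
Proof. intros Hv; exact (smooth_curve_is_deriveE J l v curve_smooth Hv). Qed.

Lemma tangent_is_deriveE (v : R) : J v ->
  is_deriveE t v (plus (l v) (scal (e * kappa v) (n v))).
Proof.
  intros Hv; rewrite <- frenet_tangent by exact Hv.
  exact (smooth_curve_is_deriveE J t v (smooth_curve_DeriveE J l curve_smooth) Hv).
Qed.

Lemma normal_is_deriveE (v : R) : J v ->
  is_deriveE n v (scal (e * kappa v) (t v)).
Proof.
  intros Hv; rewrite <- frenet_normal by exact Hv.
  exact (smooth_curve_is_deriveE J n v (proj1 hn) Hv).
Qed.

Lemma is_derive_f (u : R) : I u -> is_derive f u (Derive f u).
Proof.
  intros Hu; exact (is_derive_smooth I f u (mer_f_smooth _ _ _ _ _ _ _ hM) Hu).
Qed.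

Lemma is_derive_g (u : R) : I u -> is_derive g u (Derive g u).
Proof.
  intros Hu; exact (is_derive_smooth I g u (mer_g_smooth _ _ _ _ _ _ _ hM) Hu).
Qed.

Lemma is_derive_f' (u : R) : I u -> is_derive (Derive f) u (Derive (Derive f) u).
Proof.
  intros Hu; apply (is_derive_smooth I); [|exact Hu].
  apply smooth_on_Derive; exact (mer_f_smooth _ _ _ _ _ _ _ hM).
Qed.

Lemma is_derive_g' (u : R) : I u -> is_derive (Derive g) u (Derive (Derive g) u).
Proof.
  intros Hu; apply (is_derive_smooth I); [|exact Hu].
  apply smooth_on_Derive; exact (mer_g_smooth _ _ _ _ _ _ _ hM).
Qed.

Lemma surface_partial_u (u v : R) : I u ->
  partial_u z u v = plus (scal (Derive f u) (l v)) (scal (Derive g u) A).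
Proof.
  intros Hu; apply is_deriveE_unique, is_deriveE_varying_scalars;
    [now apply is_derive_f | now apply is_derive_g].
Qed.

Lemma surface_partial_v (u v : R) : J v -> partial_v z u v = scal (f u) (t v).
Proof.
  intros Hv; apply is_deriveE_unique; eapply is_deriveE_value.
  - apply (is_deriveE_varying_vectors (f u) (g u) v l (fun _ => A));
      [now apply curve_is_deriveE | apply is_deriveE_const].
  - apply E4_ext; coords; ring.
Qed.

Lemma surface_partial_uu (u v : R) : I u ->
  partial_u (partial_u z) u v
  = plus (scal (Derive (Derive f) u) (l v)) (scal (Derive (Derive g) u) A).
Proof.
  intros Hu; apply is_deriveE_unique.
  apply is_deriveE_ext_loc
    with (fun s => plus (scal (Derive f s) (l v)) (scal (Derive g s) A)).
  - generalize (open_interval_locally I u hI Hu); apply filter_imp.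
    intros s Hs; symmetry; now apply surface_partial_u.
  - apply is_deriveE_varying_scalars; [now apply is_derive_f' | now apply is_derive_g'].
Qed.

Lemma surface_partial_vv (u v : R) : J v ->
  partial_v (partial_v z) u v
  = scal (f u) (plus (l v) (scal (e * kappa v) (n v))).
Proof.
  intros Hv; apply is_deriveE_unique.
  apply is_deriveE_ext_loc with (fun s => scal (f u) (t s)).
  - generalize (open_interval_locally J v hJ Hv); apply filter_imp.
    intros s Hs; symmetry; now apply surface_partial_v.
  - eapply is_deriveE_value.
    + apply (is_deriveE_scal (fun _ => f u) t v 0);
        [exact (is_derive_const (f u) v) | now apply tangent_is_deriveE].
    + generalize (t v) (plus (l v) (scal (e * kappa v) (n v))); intros a b.
      apply E4_ext; coords; ring.
Qed.

(** The boost of the moving frame by [(f', g')]: its first two vectors are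
    tangent to the surface, the last two normal. *)
Lemma adapted_frame (u v : R) : I u -> J v ->
  neutral_frame e (plus (scal (Derive f u) (l v)) (scal (Derive g u) A))
    (t v) (n v) (N u v).
Proof.
  intros Hu Hv; apply neutral_frame_boost; [|now apply moving_frame].
  exact (mer_meridian _ _ _ _ _ _ _ hM u Hu).
Qed.

Lemma surface_normal_part (u v : R) (w : E4) : I u -> J v ->
  normal_part z u v w
  = minus (scal (e * inner w (n v)) (n v)) (scal (e * inner w (N u v)) (N u v)).
Proof.
  intros Hu Hv; eapply normal_part_frame.
  - exact (adapted_frame u v Hu Hv).
  - now apply surface_partial_u.
  - now apply surface_partial_v.
  - exact (mer_f_neq0 _ _ _ _ _ _ _ hM u Hu).
Qed.

Let normal_field (P Q : R) (u v : R) : E4 := plus (scal P (N u v)) (scal Q (n v)).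

Lemma field_inner_n (P Q u v : R) : I u -> J v ->
  inner (normal_field P Q u v) (n v) = e * Q.
Proof.
  intros Hu Hv; assert (HF := adapted_frame u v Hu Hv).
  unfold normal_field; rewrite inner_plus_l, !inner_scal_l, (inner_sym (N u v)),
    (frame_cd _ _ _ _ _ HF), (frame_cc _ _ _ _ _ HF); ring.
Qed.

Lemma field_inner_N (P Q u v : R) : I u -> J v ->
  inner (normal_field P Q u v) (N u v) = - e * P.
Proof.
  intros Hu Hv; assert (HF := adapted_frame u v Hu Hv).
  unfold normal_field; rewrite inner_plus_l, !inner_scal_l,
    (frame_cd _ _ _ _ _ HF), (frame_dd _ _ _ _ _ HF); ring.
Qed.

Lemma field_norm (P Q u v : R) : I u -> J v ->
  inner (normal_field P Q u v) (normal_field P Q u v) = e * (Q ^ 2 - P ^ 2).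
Proof.
  intros Hu Hv.
  change (normal_field P Q u v) with (plus (scal P (N u v)) (scal Q (n v))) at 2.
  rewrite inner_plus_r, !inner_scal_r, field_inner_n, field_inner_N by assumption.
  ring.
Qed.

Lemma normal_part_eq_field (u v : R) (w : E4) : I u -> J v ->
  normal_part z u v w = normal_field (- e * inner w (N u v)) (e * inner w (n v)) u v.
Proof.
  intros Hu Hv; rewrite surface_normal_part by assumption; unfold normal_field.
  generalize (inner w (N u v)) (inner w (n v)) (N u v) (n v).
  intros; apply E4_ext; coords; ring.
Qed.

(** Every normal part needed below is obtained by exhibiting the tangential
    component of the vector. *)
Lemma normal_part_field_plus_tangent (P Q u v p q : R) (w : E4) : I u -> J v ->
  w = plus (normal_field P Q u v) (plus (scal p (partial_u z u v)) (scal q (partial_v z u v))) ->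
  normal_part z u v w = normal_field P Q u v.
Proof.
  intros Hu Hv ->; assert (HF := adapted_frame u v Hu Hv).
  assert (He := is_sign_sqr e (frame_sign _ _ _ _ _ HF)).
  rewrite normal_part_eq_field, surface_partial_u, surface_partial_v by assumption.
  f_equal;
    rewrite inner_plus_l, ?field_inner_n, ?field_inner_N by assumption;
    rewrite (inner_plus_l (scal p _)), (inner_scal_l p), (inner_scal_l q), (inner_scal_l (f u)),
      ?(frame_ad _ _ _ _ _ HF), ?(frame_bd _ _ _ _ _ HF),
      ?(frame_ac _ _ _ _ _ HF), ?(frame_bc _ _ _ _ _ HF).
  - transitivity (e * e * P); [ring | rewrite He; ring].
  - transitivity (e * e * Q); [ring | rewrite He; ring].
Qed.

Lemma field_eq_zero (P Q u v : R) : I u -> J v ->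
  normal_field P Q u v = zero -> P = 0 /\ Q = 0.
Proof.
  intros Hu Hv H0.
  assert (He := is_sign_sqr e (frame_sign _ _ _ _ _ (adapted_frame u v Hu Hv))).
  generalize (field_inner_n P Q u v Hu Hv) (field_inner_N P Q u v Hu Hv).
  rewrite H0, !inner_zero_l; intros HQ HP; split.
  - transitivity (e * e * P); [rewrite He; ring|].
    transitivity (- (e * (- e * P))); [ring | rewrite <- HP; ring].
  - transitivity (e * e * Q); [rewrite He; ring|].
    transitivity (e * (e * Q)); [ring | rewrite <- HQ; ring].
Qed.

(** [N] and [n] are parallel: [n] does not depend on [u], and
    [N_u = g'' l + f'' axis = (f''/g') z_u] by [meridian_acceleration]. *)
Lemma D_u_field (xi : R -> R -> E4) (P Q : R -> R) (u v P' Q' : R) :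
  I u -> J v -> (forall s, I s -> xi s v = normal_field (P s) (Q s) s v) ->
  is_derive P u P' -> is_derive Q u Q' -> D_u z xi u v = normal_field P' Q' u v.
Proof.
  intros Hu Hv Hxi HP HQ; unfold D_u.
  (* the tangential component of [P N_u] along [z_u] *)
  set (r := P u * (Derive (Derive f) u / Derive g u)).
  apply normal_part_field_plus_tangent with r 0; auto.
  rewrite surface_partial_u by exact Hu.
  apply is_deriveE_unique.
  apply is_deriveE_ext_loc with (fun s => normal_field (P s) (Q s) s v).
  { generalize (open_interval_locally I u hI Hu); apply filter_imp.
    intros s Hs; symmetry; auto. }
  eapply is_deriveE_value.
  - apply is_deriveE_plus; apply is_deriveE_scal.
    + exact HP.
    + apply is_deriveE_varying_scalars; [now apply is_derive_g' | now apply is_derive_f'].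
    + exact HQ.
    + apply is_deriveE_const.
  - assert (Hr1 : P u * Derive (Derive f) u = r * Derive g u).
    { unfold r; field; auto. }
    assert (Hr2 : P u * Derive (Derive g) u = r * Derive f u).
    { assert (Hacc := meridian_acceleration I f g u hI surface_meridian Hu).
      apply Rmult_eq_reg_l with (Derive g u); [|auto].
      transitivity (P u * (Derive g u * Derive (Derive g) u)); [ring|].
      rewrite <- Hacc; unfold r; field; auto. }
    unfold normal_field, N.
    revert Hr1 Hr2; clearbody r.
    generalize (Derive (Derive f) u) (Derive (Derive g) u) (Derive f u) (Derive g u)
      (P u) (Q u) (l v) A (n v) (partial_v z u v).
    intros f2 g2 f1 g1 p q a d c b Hr1 Hr2.
    assert (H : forall s s' : R, p * (g2 * s + f2 * s') = r * (f1 * s + g1 * s')).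
    { intros s s'; transitivity (p * g2 * s + p * f2 * s'); [ring|].
      rewrite Hr1, Hr2; ring. }
    apply E4_ext; coords; rewrite H; ring.
Qed.

(** Again [N] and [n] are parallel, since [N_v = g' t] and [n_v = k t] are
    multiples of [z_v = f t]. Hence a field is parallel exactly when its
    components in [N] and [n] are constant. *)
Lemma D_v_field (xi : R -> R -> E4) (P Q : R -> R) (u v P' Q' : R) :
  I u -> J v -> (forall s, J s -> xi u s = normal_field (P s) (Q s) u s) ->
  is_derive P v P' -> is_derive Q v Q' -> D_v z xi u v = normal_field P' Q' u v.
Proof.
  intros Hu Hv Hxi HP HQ; unfold D_v.
  assert (Hf := mer_f_neq0 _ _ _ _ _ _ _ hM u Hu).
  apply normal_part_field_plus_tangent
    with 0 ((P v * Derive g u + Q v * (e * kappa v)) / f u); auto.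
  rewrite surface_partial_v by exact Hv.
  apply is_deriveE_unique.
  apply is_deriveE_ext_loc with (fun s => normal_field (P s) (Q s) u s).
  { generalize (open_interval_locally J v hJ Hv); apply filter_imp.
    intros s Hs; symmetry; auto. }
  eapply is_deriveE_value.
  - apply is_deriveE_plus; apply is_deriveE_scal.
    + exact HP.
    + apply (is_deriveE_varying_vectors _ _ v l (fun _ => A));
        [now apply curve_is_deriveE | apply is_deriveE_const].
    + exact HQ.
    + now apply normal_is_deriveE.
  - unfold normal_field; revert Hf; generalize (N u v) (partial_u z u v) (P v) (Q v) (f u)
      (Derive g u) (Derive f u) (t v) (n v) (e * kappa v).
    intros c d p q r g1 f1 b a k Hf.
    apply E4_ext; coords; field_simplify_eq; auto; ring.
Qed.

(** [h_uu = (f''/g') N], [h_vv = f k n - f g' N] and [F = 0]. *)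
Lemma surface_mean_curvature (u v : R) : I u -> J v ->
  mean_curvature z u v
  = normal_field (e * mu u / (2 * f u)) (- kappa v / (2 * f u)) u v.
Proof.
  intros Hu Hv.
  assert (HF := adapted_frame u v Hu Hv).
  assert (HM0 := moving_frame v Hv).
  assert (He := is_sign_sqr e (frame_sign _ _ _ _ _ HF)).
  assert (Hf := mer_f_neq0 _ _ _ _ _ _ _ hM u Hu).
  assert (Hg := hg u Hu).
  assert (Hacc := meridian_acceleration I f g u hI surface_meridian Hu).
  assert (Hsp := mer_meridian _ _ _ _ _ _ _ hM u Hu).
  assert (Huu : h_uu z u v = scal (Derive (Derive f) u / Derive g u) (N u v)).
  { unfold h_uu.
    transitivity (normal_field (Derive (Derive f) u / Derive g u) 0 u v).
    - apply normal_part_field_plus_tangent with 0 0; auto.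
      rewrite surface_partial_uu by exact Hu.
      assert (Hg2 : Derive (Derive g) u = Derive (Derive f) u / Derive g u * Derive f u).
      { apply Rmult_eq_reg_l with (Derive g u); [|exact Hg].
        rewrite <- Hacc; field; exact Hg. }
      rewrite Hg2; unfold normal_field, N; clear - Hg; revert Hg.
      generalize (partial_u z u v) (partial_v z u v) (Derive (Derive f) u)
        (Derive f u) (Derive g u) (l v) A (n v).
      intros b d f2 f1 g1 a A' c Hg; apply E4_ext; coords; field; exact Hg.
    - unfold normal_field; generalize (N u v) (n v) (Derive (Derive f) u / Derive g u).
      intros; apply E4_ext; coords; ring. }
  assert (Hvv : h_vv z u v = normal_field (- (f u * Derive g u)) (f u * (e * kappa v)) u v).
  { unfold h_vv; apply normal_part_field_plus_tangent with (f u * Derive f u) 0; auto.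
    rewrite surface_partial_vv, surface_partial_u by assumption.
    unfold normal_field, N; clear - Hsp; revert Hsp.
    generalize (partial_v z u v) (f u) (Derive f u) (Derive g u) (l v) A (n v)
      (e * kappa v).
    intros d r f1 g1 a A' c k Hsp.
    assert (Hf2 : f1 ^ 2 = 1 + g1 ^ 2) by lra.
    apply E4_ext; coords; ring [Hf2]. }
  unfold mean_curvature; rewrite Huu, Hvv.
  unfold ffdet, ffE, ffF, ffG; rewrite surface_partial_u, surface_partial_v by assumption.
  rewrite !(inner_scal_r (f u)), !(inner_scal_l (f u)), (frame_aa _ _ _ _ _ HF),
    (frame_ab _ _ _ _ _ HF), (frame_bb _ _ _ _ _ HF).
  unfold mu, axial_trace, normal_field.
  replace (f u * Derive (Derive f) u + Derive f u ^ 2 - 1)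
    with (f u * Derive (Derive f) u + Derive g u ^ 2) by lra.
  destruct (frame_sign _ _ _ _ _ HF) as [He1 | He1]; rewrite He1; revert Hf Hg; clear;
    generalize (N u v) (n v) (h_uv z u v) (Derive (Derive f) u) (Derive g u) (f u)
      (kappa v);
    intros d c w f2 g1 r k Hr Hg1; apply E4_ext; coords; field; split; assumption.
Qed.


Lemma ex_derive_mu (u : R) : I u -> ex_derive mu u.
Proof.
  intros Hu.
  assert (Hf'' : ex_derive (Derive (Derive f)) u).
  { apply (smooth_on_ex_derive I); [|exact Hu].
    apply smooth_on_Derive, smooth_on_Derive; exact (mer_f_smooth _ _ _ _ _ _ _ hM). }
  apply (ex_derive_div (fun s => f s * Derive (Derive f) s + Derive f s ^ 2 - 1)).
  - apply @ex_derive_minus; [|apply ex_derive_const].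
    apply @ex_derive_plus.
    + apply (ex_derive_mult f); [|exact Hf''].
      eexists; now apply is_derive_f.
    + apply (ex_derive_pow (Derive f)); eexists; now apply is_derive_f'.
  - eexists; now apply is_derive_g'.
  - now apply hg.
Qed.

(** The component [-kappa/(2f)] along [n] would be constant in [u]; but where
    [kappa <> 0] its derivative is not zero, because [f'^2 = 1 + g'^2]. *)
Lemma mean_curvature_not_parallel :
  (exists v, J v /\ kappa v <> 0) -> ~ parallel_mean_curvature I J z.
Proof.
  intros [v [Hv Hk]] Hpar.
  destruct (open_interval_inhabited I hI) as [u Hu].
  assert (Hf := mer_f_neq0 _ _ _ _ _ _ _ hM u Hu).
  destruct (Hpar u v Hu Hv) as [HD _].
  assert (HP : ex_derive (fun s => e * mu s / (2 * f s)) u).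
  { apply ex_derive_div; [| |lra].
    - apply ex_derive_scal; now apply ex_derive_mu.
    - apply ex_derive_scal; eexists; now apply is_derive_f. }
  assert (HQ : is_derive (fun s => - kappa v / (2 * f s)) u
                 (kappa v * Derive f u / (2 * f u ^ 2))).
  { eapply is_derive_value.
    - apply is_derive_div.
      + exact (is_derive_const (- kappa v) u).
      + apply is_derive_scal; now apply is_derive_f.
      + lra.
    - unfold zero; simpl; field; exact Hf. }
  destruct HP as [P' HP].
  rewrite (D_u_field _ (fun s => e * mu s / (2 * f s)) (fun s => - kappa v / (2 * f s))
             u v _ _ Hu Hv) with (2 := HP) (3 := HQ) in HD.
  2:{ intros s Hs; now apply surface_mean_curvature. }
  destruct (field_eq_zero _ _ u v Hu Hv HD) as [_ H0].
  assert (Hf' := meridian_f'_neq0 I f g u surface_meridian Hu).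
  apply Rmult_integral in H0; destruct H0 as [H0 | H0].
  - destruct (Rmult_integral _ _ H0); auto.
  - revert H0; apply Rinv_neq_0_compat.
    apply Rmult_integral_contrapositive_currified; [lra|].
    now apply pow_nonzero.
Qed.

Lemma normal_eq_field (u v : R) (w : E4) : I u -> J v -> is_normal z u v w ->
  w = normal_field (- e * inner w (N u v)) (e * inner w (n v)) u v.
Proof.
  intros Hu Hv [H1 H2].
  rewrite <- normal_part_eq_field by assumption.
  unfold normal_part, tangent_part; rewrite H1, H2, !Rmult_0_r.
  unfold Rdiv; rewrite !Rminus_0_r, !Rmult_0_l.
  generalize (partial_u z u v) (partial_v z u v); intros a b.
  apply E4_ext; coords; ring.
Qed.

Lemma smooth_field_is_deriveE (b : R -> R -> E4) (u v : R) :
  smooth_field_on I J b -> I u -> J v ->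
  is_deriveE (fun s => b s v) u (partial_u b u v) /\
  is_deriveE (fun s => b u s) v (partial_v b u v).
Proof.
  intros [B1 [B2 [B3 B4]]] Hu Hv.
  destruct (B1 u v Hu Hv 1%nat) as [_ [D1 [D1' _]]].
  destruct (B2 u v Hu Hv 1%nat) as [_ [D2 [D2' _]]].
  destruct (B3 u v Hu Hv 1%nat) as [_ [D3 [D3' _]]].
  destruct (B4 u v Hu Hv 1%nat) as [_ [D4 [D4' _]]].
  split; (split; [|split; [|split]]); apply Derive_correct; assumption.
Qed.

Lemma parallel_normal_field_constant (b : R -> R -> E4) :
  smooth_field_on I J b ->
  (forall u v, I u -> J v -> is_normal z u v (b u v)) ->
  parallel_on I J z b ->
  exists P Q, forall u v, I u -> J v -> b u v = normal_field P Q u v.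
Proof.
  intros Hs Hnor Hpar.
  set (P := fun u v => - e * inner (b u v) (N u v)).
  set (Q := fun u v => e * inner (b u v) (n v)).
  assert (Hb : forall u v, I u -> J v -> b u v = normal_field (P u v) (Q u v) u v).
  { intros u v Hu Hv; apply normal_eq_field; auto. }
  assert (HuN : forall u v, I u -> J v ->
            is_derive (fun s => P s v) u 0 /\ is_derive (fun s => Q s v) u 0).
  { intros u v Hu Hv; destruct (smooth_field_is_deriveE b u v Hs Hu Hv) as [Db _].
    assert (DP : exists d, is_derive (fun s => P s v) u d).
    { eexists; apply (is_derive_scal (fun s => inner (b s v) (N s v))).
      apply is_derive_inner; [exact Db|].
      apply is_deriveE_varying_scalars; [now apply is_derive_g' | now apply is_derive_f']. }
    assert (DQ : exists d, is_derive (fun s => Q s v) u d).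
    { eexists; apply (is_derive_scal (fun s => inner (b s v) (n v))).
      apply is_derive_inner; [exact Db | apply is_deriveE_const]. }
    destruct DP as [P' DP]; destruct DQ as [Q' DQ].
    destruct (field_eq_zero _ _ u v Hu Hv (eq_trans
      (eq_sym (D_u_field b (fun s => P s v) (fun s => Q s v) u v _ _ Hu Hv
                 (fun s Hs' => Hb s v Hs' Hv) DP DQ))
      (proj1 (Hpar u v Hu Hv)))) as [H1 H2].
    split; [rewrite H1 in DP; exact DP | rewrite H2 in DQ; exact DQ]. }
  assert (HvN : forall u v, I u -> J v ->
            is_derive (fun s => P u s) v 0 /\ is_derive (fun s => Q u s) v 0).
  { intros u v Hu Hv; destruct (smooth_field_is_deriveE b u v Hs Hu Hv) as [_ Db].
    assert (DP : exists d, is_derive (fun s => P u s) v d).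
    { eexists; apply (is_derive_scal (fun s => inner (b u s) (N u s))).
      apply is_derive_inner; [exact Db|].
      apply (is_deriveE_varying_vectors _ _ v l (fun _ => A));
        [now apply curve_is_deriveE | apply is_deriveE_const]. }
    assert (DQ : exists d, is_derive (fun s => Q u s) v d).
    { eexists; apply (is_derive_scal (fun s => inner (b u s) (n s))).
      apply is_derive_inner; [exact Db | now apply normal_is_deriveE]. }
    destruct DP as [P' DP]; destruct DQ as [Q' DQ].
    destruct (field_eq_zero _ _ u v Hu Hv (eq_trans
      (eq_sym (D_v_field b (fun s => P u s) (fun s => Q u s) u v _ _ Hu Hv
                 (fun s Hs' => Hb u s Hu Hs') DP DQ))
      (proj2 (Hpar u v Hu Hv)))) as [H1 H2].
    split; [rewrite H1 in DP; exact DP | rewrite H2 in DQ; exact DQ]. }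
  destruct (open_interval_inhabited I hI) as [u0 Hu0].
  destruct (open_interval_inhabited J hJ) as [v0 Hv0].
  exists (P u0 v0), (Q u0 v0); intros u v Hu Hv; rewrite (Hb u v Hu Hv).
  f_equal.
  - transitivity (P u0 v).
    + apply (constant_of_derive_zero I (fun s => P s v)); auto.
      intros s Hs'; exact (proj1 (HuN s v Hs' Hv)).
    + apply (constant_of_derive_zero J (P u0)); auto.
      intros s Hs'; exact (proj1 (HvN u0 s Hu0 Hs')).
  - transitivity (Q u0 v).
    + apply (constant_of_derive_zero I (fun s => Q s v)); auto.
      intros s Hs'; exact (proj2 (HuN s v Hs' Hv)).
    + apply (constant_of_derive_zero J (Q u0)); auto.
      intros s Hs'; exact (proj2 (HvN u0 s Hu0 Hs')).
Qed.

Lemma field_smooth (P Q : R) : smooth_field_on I J (normal_field P Q).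
Proof.
  assert (Sf' := smooth_on_Derive I f (mer_f_smooth _ _ _ _ _ _ _ hM)).
  assert (Sg' := smooth_on_Derive I g (mer_g_smooth _ _ _ _ _ _ _ hM)).
  assert (Hscal : forall (c : R) (h : R -> R), smooth_on J h ->
            smooth_on J (fun v => c * h v)).
  { intros c h Sh; apply smooth_on_elementary; [exact hJ|].
    apply (gen_mult _ (fun _ => c)); apply gen_base, elem_smooth;
      [now apply smooth_on_const | exact Sh]. }
  assert (HC : forall (li ni : R -> R) (ai : R), smooth_on J li -> smooth_on J ni ->
            smooth_on2 I J (fun u v =>
              P * (Derive g u * li v + Derive f u * ai) + Q * ni v)).
  { intros li ni ai Sl Sn.
    apply smooth_on2_ext with (fun u v =>
      Derive g u * (P * li v) + Derive f u * (P * ai) + 1 * (Q * ni v)).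
    { intros u v; ring. }
    apply smooth_on2_separable_sum; auto.
    apply (sep_plus I J
      (fun u v => Derive g u * (P * li v) + Derive f u * (P * ai))
      (fun u v => 1 * (Q * ni v))).
    - apply (sep_plus I J (fun u v => Derive g u * (P * li v))
        (fun u v => Derive f u * (P * ai))).
      + apply (sep_mult I J (Derive g)); auto.
      + apply (sep_mult I J (Derive f) (fun _ => P * ai)); auto.
        now apply smooth_on_const.
    - apply (sep_mult I J (fun _ => 1)); auto.
      now apply smooth_on_const. }
  destruct curve_smooth as [L1 [L2 [L3 L4]]].
  destruct (proj1 hn) as [N1 [N2 [N3 N4]]].
  split; [|split; [|split]].
  - exact (HC _ _ (x1 A) L1 N1).
  - exact (HC _ _ (x2 A) L2 N2).
  - exact (HC _ _ (x3 A) L3 N3).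
  - exact (HC _ _ (x4 A) L4 N4).
Qed.

(** A parallel unit normal field is [P N + Q n] with constants [P] and [Q]; the
    mean curvature vector is proportional to it exactly when [(mu, kappa)] stays
    on a fixed line, and [Q <> 0] because [kappa] is not identically zero. The
    slope satisfies [r^2 <> 1] since [<H, H>] is a multiple of [1 - r^2]. *)
Lemma parallel_normalized_iff :
  (exists v, J v /\ kappa v <> 0) ->
  parallel_normalized_mean_curvature I J z <->
  exists r, r ^ 2 <> 1 /\ (forall v, J v -> kappa v <> 0) /\
    forall u v, I u -> J v -> mu u = r * kappa v.
Proof.
  intros [v0 [Hv0 Hk0]].
  destruct (open_interval_inhabited I hI) as [u0 Hu0].
  assert (He : is_sign e) by exact (frame_sign _ _ _ _ _ (moving_frame v0 Hv0)).
  assert (He2 := is_sign_sqr e He).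
  assert (Hf0 := mer_f_neq0 _ _ _ _ _ _ _ hM).
  split.
  - intros [HH [b [Hs [Hb Hpar]]]].
    destruct (parallel_normal_field_constant b Hs) as [P [Q HPQ]]; auto.
    { intros u v Hu Hv; exact (proj1 (Hb u v Hu Hv)). }
    assert (Hlam : forall u v, I u -> J v -> exists c, c <> 0 /\
              mu u = e * c * P /\ kappa v = - c * Q).
    { intros u v Hu Hv; destruct (Hb u v Hu Hv) as [_ [_ [lambda [Hl HL]]]].
      assert (Hf := Hf0 u Hu).
      (* [lambda] times the factor [2 f] that clears the denominators of [H]. *)
      exists (2 * f u * lambda); split.
      { repeat apply Rmult_integral_contrapositive_currified; auto; lra. }
      rewrite surface_mean_curvature, HPQ in HL by assumption.
      assert (Hn := f_equal (fun w => inner w (n v)) HL); simpl in Hn.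
      assert (HN := f_equal (fun w => inner w (N u v)) HL); simpl in HN.
      rewrite inner_scal_l, !field_inner_n in Hn by assumption.
      rewrite inner_scal_l, !field_inner_N in HN by assumption.
      split.
      - transitivity (- (2 * f u) * (- e * (e * mu u / (2 * f u))) * (e * e) * (e * e)).
        + transitivity (e * e * (e * e) * (e * e) * mu u); [rewrite He2; ring|field; exact Hf].
        + rewrite HN, He2; ring [He2].
      - transitivity (- (2 * f u) * (e * (- kappa v / (2 * f u))) * e).
        + transitivity (e * e * kappa v); [rewrite He2; ring | field; exact Hf].
        + rewrite Hn; ring [He2]. }
    assert (HQ : Q <> 0).
    { destruct (Hlam u0 v0 Hu0 Hv0) as [c [_ [_ Hc]]].
      intros ->; apply Hk0; rewrite Hc; ring. }
    assert (Hr : forall u v, I u -> J v -> mu u = - (e * P / Q) * kappa v).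
    { intros u v Hu Hv; destruct (Hlam u v Hu Hv) as [c [_ [-> ->]]]; field; exact HQ. }
    exists (- (e * P / Q)); split; [|split; [|exact Hr]].
    + intros H1; apply (HH u0 v0 Hu0 Hv0).
      assert (Hf := Hf0 u0 Hu0).
      rewrite surface_mean_curvature, field_norm by assumption.
      rewrite (Hr u0 v0 Hu0 Hv0); set (r := - (e * P / Q)) in *.
      transitivity (e * (kappa v0 / (2 * f u0)) ^ 2 * (1 - e * e * r ^ 2)).
      * field; exact Hf.
      * rewrite He2, H1; ring.
    + intros v Hv; destruct (Hlam u0 v Hu0 Hv) as [c [Hc [_ ->]]].
      apply Rmult_integral_contrapositive_currified; [lra | exact HQ].
  - intros [r [Hr [Hk Hmu]]].
    assert (Hq : 0 < Rabs (1 - r ^ 2)) by (apply Rabs_pos_lt; lra).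
    (* [H] is a multiple of [e r N - n], of square norm [e (1 - r^2)]; [s]
       normalizes this field. *)
    set (s := / sqrt (Rabs (1 - r ^ 2))).
    assert (Hsq : 0 < sqrt (Rabs (1 - r ^ 2))) by now apply sqrt_lt_R0.
    assert (Hs : 0 < s) by now apply Rinv_0_lt_compat.
    assert (Hs2 : s * s * Rabs (1 - r ^ 2) = 1).
    { rewrite <- (sqrt_sqrt (Rabs (1 - r ^ 2))) by lra; unfold s; field; lra. }
    assert (HHb : forall u v, I u -> J v ->
              mean_curvature z u v
              = scal (kappa v / (2 * f u * s)) (normal_field (s * (e * r)) (- s) u v)).
    { intros u v Hu Hv; assert (Hf := Hf0 u Hu).
      rewrite surface_mean_curvature, (Hmu u v Hu Hv) by assumption.
      unfold normal_field; assert (Hs0 : s <> 0) by lra.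
      revert Hf Hs0; generalize (N u v) (n v) (f u) (kappa v) s e; clear.
      intros d c f0 k s e Hf Hs; apply E4_ext; coords; field; auto. }
    split.
    + intros u v Hu Hv; assert (Hf := Hf0 u Hu).
      rewrite surface_mean_curvature, field_norm, (Hmu u v Hu Hv) by assumption.
      replace (e * ((- kappa v / (2 * f u)) ^ 2 - (e * (r * kappa v) / (2 * f u)) ^ 2))
        with (e * (kappa v / (2 * f u)) ^ 2 * (1 - e * e * r ^ 2)) by (field; exact Hf).
      rewrite He2, Rmult_1_l.
      apply Rmult_integral_contrapositive_currified; [|lra].
      apply Rmult_integral_contrapositive_currified.
      * destruct He as [He | He]; rewrite He; lra.
      * apply pow_nonzero; apply Rmult_integral_contrapositive_currified; [auto|].
        apply Rinv_neq_0_compat; lra.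
    + exists (normal_field (s * (e * r)) (- s)); split; [apply field_smooth|split].
      * intros u v Hu Hv; split; [|split].
        -- assert (HF := adapted_frame u v Hu Hv); split.
           ++ rewrite surface_partial_u by exact Hu; unfold normal_field.
              rewrite inner_plus_l, (inner_scal_l (s * (e * r))), (inner_scal_l (- s)).
              rewrite (inner_sym (N u v)), (inner_sym (n v)),
                (frame_ad _ _ _ _ _ HF), (frame_ac _ _ _ _ _ HF); ring.
           ++ rewrite surface_partial_v by exact Hv; unfold normal_field.
              rewrite inner_plus_l, !inner_scal_l, !inner_scal_r.
              rewrite (inner_sym (N u v)), (inner_sym (n v)),
                (frame_bd _ _ _ _ _ HF), (frame_bc _ _ _ _ _ HF); ring.
        -- unfold is_unit_vector; rewrite field_norm by assumption.
           replace ((- s) ^ 2 - (s * (e * r)) ^ 2) with (s * s * (1 - e * e * r ^ 2)) by ring.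
           rewrite He2, Rmult_1_l.
           destruct (Rlt_or_le 0 (1 - r ^ 2)) as [Hp | Hn].
           ++ rewrite Rabs_pos_eq in Hs2 by lra; rewrite Hs2.
              destruct He as [He | He]; rewrite He; lra.
           ++ rewrite Rabs_left1 in Hs2 by lra.
              destruct He as [He | He]; rewrite He; lra.
        -- exists (kappa v / (2 * f u * s)); split; [|now apply HHb].
           assert (Hf := Hf0 u Hu).
           apply Rmult_integral_contrapositive_currified; [auto|].
           apply Rinv_neq_0_compat.
           repeat apply Rmult_integral_contrapositive_currified; auto; lra.
      * intros u v Hu Hv; split.
        -- rewrite (D_u_field _ (fun _ => s * (e * r)) (fun _ => - s) u v 0 0 Hu Hv).
           ++ unfold normal_field; generalize (N u v) (n v); intros d c.
              apply E4_ext; coords; ring.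
           ++ reflexivity.
           ++ apply @is_derive_const.
           ++ apply @is_derive_const.
        -- rewrite (D_v_field _ (fun _ => s * (e * r)) (fun _ => - s) u v 0 0 Hu Hv).
           ++ unfold normal_field; generalize (N u v) (n v); intros d c.
              apply E4_ext; coords; ring.
           ++ reflexivity.
           ++ apply @is_derive_const.
           ++ apply @is_derive_const.
Qed.

End MeridianSurface.

Theorem theorem5p2 (K : meridian_kind) (I J : R -> Prop) (f g w1 w2 : R -> R)
    (n : R -> E4)
    (hI : is_open_interval I) (hJ : is_open_interval J)
    (hM : is_meridian_surface K I J f g w1 w2)
    (hg : forall u, I u -> Derive g u <> 0)
    (hn : is_frame_normal K J w1 w2 n)
    (hkappa : exists v, J v /\ spherical_curvature K w1 w2 n v <> 0) :
  (parallel_normalized_mean_curvature I J (meridian_surface K f g w1 w2) /\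
   ~ parallel_mean_curvature I J (meridian_surface K f g w1 w2))
  <->
  (case_i I J f g (spherical_curvature K w1 w2 n) \/
   case_ii I J f g (spherical_curvature K w1 w2 n)).
Proof.
  assert (HM := surface_meridian K I J f g w1 w2 hM hg).
  assert (Hnot := mean_curvature_not_parallel K I J f g w1 w2 n hI hJ hM hg hn hkappa).
  assert (Hiff := parallel_normalized_iff K I J f g w1 w2 n hI hJ hM hg hn hkappa).
  set (kappa := spherical_curvature K w1 w2 n) in *.
  destruct (open_interval_inhabited I hI) as [u0 Hu0].
  destruct (open_interval_inhabited J hJ) as [v0 Hv0].
  split.
  - intros [Hpn _].
    destruct (proj1 Hiff Hpn) as [r [Hr [Hk Hmu]]].
    destruct (Req_dec r 0) as [Hr0 | Hr0].
    + left; split; [exact Hk|].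
      apply axial_trace_zero_iff; auto.
      intros u Hu; rewrite (Hmu u v0 Hu Hv0), Hr0; ring.
    (* [mu = r kappa] separates the variables, so both sides are constant. *)
    + right; exists (kappa v0); split; [auto|split].
      * intros v Hv; apply Rmult_eq_reg_l with r; [|exact Hr0].
        rewrite <- (Hmu u0 v Hu0 Hv), <- (Hmu u0 v0 Hu0 Hv0); reflexivity.
      * apply axial_trace_nonzero_constant_iff; auto.
        exists (r * kappa v0); split; [|split].
        -- apply Rmult_integral_contrapositive_currified; auto.
        -- intros E; apply Hr.
           apply Rmult_eq_reg_r with (kappa v0 ^ 2); [|now apply pow_nonzero, Hk].
           transitivity ((r * kappa v0) ^ 2); [ring | rewrite E; ring].
        -- intros u Hu; now apply Hmu.
  - intros Hcases; split; [apply Hiff | exact Hnot].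
    destruct Hcases as [[Hk Hmer] | [k [Hk0 [Hk Hmer]]]].
    + exists 0; split; [lra | split; [exact Hk|]].
      intros u v Hu _; rewrite (proj2 (axial_trace_zero_iff I f g hI HM) Hmer u Hu); ring.
    + destruct (proj2 (axial_trace_nonzero_constant_iff I f g k hI HM) Hmer)
        as [m [Hm0 [Hmk Hm]]].
      exists (m / k); split; [|split].
      * intros E; apply Hmk.
        transitivity ((m / k) ^ 2 * k ^ 2); [field; exact Hk0 | rewrite E; ring].
      * intros v Hv; rewrite Hk by exact Hv; exact Hk0.
      * intros u v Hu Hv; rewrite Hk, Hm by assumption; field; exact Hk0.
Qed.
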